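(* The functor $\rho_S^{-1}:\mathrm{Mod}(\mathbb{C}_{X_{sa}\times S})\to \mathrm{Mod}(\mathbb{C}_{X\times S})$ has a left adjoint, denoted by $\rho_{S!}$. The functor $\rho_{S!}$ is exact and commutes with tensor products.
   Context: $X$ and $S$ are real analytic manifolds. $\mathrm{op}(X_{sa})$ is the category of open subanalytic subsets of $X$; in the subanalytic site $X_{sa}$ a family $\Sigma \subset \mathrm{op}(X_{sa})$ is a covering of $U$ if for every compact $K\subset X$ there is a finite $\Sigma_0\subset \Sigma$ with $K\cap\bigcup_{V\in \Sigma_0}V=K\cap U$. The site $X_{sa}\times S$: open sets are finite unions of products $U\times V$ with $U\in \mathrm{op}(X_{sa})$, $V$ open in $S$. A family is a covering of $U\times V$ iff it admits a refinement $\{U_i\times V_j\}_{i\in I,j\in J}$ with $\{U_i\}_{i\in I}$ a covering of $U$ in $X_{sa}$ and $\{V_j\}_{j\in J}$ an open covering of $V$; a family $T$ covers a general $W$ if for each product $U\times V\subset W$ the restriction of $T$ to $U\times V$ is a covering of $U\times V$. $\rho_S: X\times S\to X_{sa}\times S$ is the natural morphism of sites induced by the inclusion of families of open subsets ($X\times S$ carries the usual topology), and $\rho_S^{-1}$ is the inverse image functor. $\mathrm{Mod}(\mathbb{C}_{\mathcal{X}})$ is the category of sheaves of $\mathbb{C}$-vector spaces on a site $\mathcal{X}$. *)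

(* Defs.v *)
From HB Require Import structures.
From mathcomp Require Import all_boot all_order all_algebra.
From mathcomp Require Import all_classical all_reals all_analysis.
From mathcomp Require Import complex.
From mathcomp Require Import freeg.

Set Implicit Arguments.
Unset Strict Implicit.
Unset Printing Implicit Defensive.

Import Order.TTheory GRing.Theory Num.Theory.
Import numFieldNormedType.Exports.

Local Open Scope classical_set_scope.
Local Open Scope ring_scope.

Definition linear_of (K : fieldType) (U V : lmodType K) (f : U -> V)
    (fl : linear f) : {linear U -> V} :=
  HB.pack f (GRing.isLinear.Build K U V *:%R f fl).

Lemma linear_id (K : fieldType) (U : lmodType K) : linear (@idfun U).
Proof. by []. Qed.

Definition idlin (K : fieldType) (U : lmodType K) : {linear U -> U} :=
  linear_of (@linear_id K U).

Section DependentProduct.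
Context (K : fieldType) (I : Type) (V : I -> lmodType K).

Definition dprod : Type := forall i, V i.

HB.instance Definition _ := gen_eqMixin dprod.
HB.instance Definition _ := gen_choiceMixin dprod.

Implicit Types f g h : dprod.

Let dadd f g : dprod := fun i => f i + g i.
Let dzero : dprod := fun i => 0.
Let dopp f : dprod := fun i => - f i.
Let dscale (k : K) f : dprod := fun i => k *: f i.

Let daddA : associative dadd.
Proof. by move=> f g h; apply: functional_extensionality_dep => i; exact: addrA. Qed.
Let daddC : commutative dadd.
Proof. by move=> f g; apply: functional_extensionality_dep => i; exact: addrC. Qed.
Let dadd0 : left_id dzero dadd.
Proof. by move=> f; apply: functional_extensionality_dep => i; exact: add0r. Qed.
Let daddN : left_inverse dzero dopp dadd.
Proof. by move=> f; apply: functional_extensionality_dep => i; exact: addNr. Qed.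

HB.instance Definition _ :=
  GRing.isZmodule.Build dprod daddA daddC dadd0 daddN.

Let dscaleA k l f : dscale k (dscale l f) = dscale (k * l) f.
Proof. by apply: functional_extensionality_dep => i; exact: scalerA. Qed.
Let dscale1 : left_id 1 dscale.
Proof. by move=> f; apply: functional_extensionality_dep => i; exact: scale1r. Qed.
Let dscaleDr : right_distributive dscale +%R.
Proof. by move=> k f g; apply: functional_extensionality_dep => i; exact: scalerDr. Qed.
Let dscaleDl f : {morph dscale^~ f : k l / k + l}.
Proof. by move=> k l; apply: functional_extensionality_dep => i; exact: scalerDl. Qed.

HB.instance Definition _ :=
  GRing.Zmodule_isLmodule.Build K dprod dscaleA dscale1 dscaleDr dscaleDl.

End DependentProduct.

Section DependentProductMap.
Context (K : fieldType) (I : Type) (V W : I -> lmodType K).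
Context (f : forall i, {linear V i -> W i}).

Lemma dprod_map_linear :
  linear (fun (s : dprod V) => (fun i => f i (s i)) : dprod W).
Proof.
by move=> k s t; apply: functional_extensionality_dep => i; exact: linearP.
Qed.

Definition dprod_map : {linear dprod V -> dprod W} := linear_of dprod_map_linear.

End DependentProductMap.

Record subspace (K : fieldType) (V : lmodType K) := Subspace {
  in_subspace :> V -> Prop;
  subspace0 : in_subspace 0;
  subspaceP : forall (k : K) u v,
    in_subspace u -> in_subspace v -> in_subspace (k *: u + v) }.

Section SubspaceTheory.
Context (K : fieldType) (V : lmodType K) (N : subspace V).

Lemma subspaceD u v : N u -> N v -> N (u + v).
Proof. by move=> Nu Nv; rewrite -[u]scale1r; exact: subspaceP. Qed.

Lemma subspaceZ k u : N u -> N (k *: u).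
Proof. by move=> Nu; rewrite -[_ *: _]addr0; exact/subspaceP/subspace0. Qed.

Lemma subspaceN u : N u -> N (- u).
Proof. by move=> Nu; rewrite -scaleN1r; exact: subspaceZ. Qed.

Lemma subspaceB u v : N u -> N v -> N (u - v).
Proof. by move=> Nu Nv; exact/subspaceD/subspaceN. Qed.

End SubspaceTheory.

Definition full_subspace (K : fieldType) (V : lmodType K) : subspace V :=
  @Subspace K V (fun=> True) I (fun _ _ _ _ _ => I).

Section Span.
Context (K : fieldType) (V : lmodType K) (E : V -> Prop).

Let spanned v := forall N : subspace V, (forall e, E e -> N e) -> N v.

Let spanned0 : spanned 0. Proof. by move=> N _; exact: subspace0. Qed.

Let spannedP k u v : spanned u -> spanned v -> spanned (k *: u + v).
Proof. by move=> su sv N EN; apply: subspaceP; [exact: su | exact: sv]. Qed.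

Definition span : subspace V := Subspace spanned0 spannedP.

Lemma span_gen e : E e -> span e.
Proof. by move=> Ee N; apply. Qed.

End Span.

(* [subquot M N] is the vector space M / (M \cap N), realized as the set of
   cosets. *)
Section Subquotient.
Context (K : fieldType) (V : lmodType K) (M N : subspace V).

Definition coset (v : V) : set V := [set w | M w /\ N (v - w)].

Definition subquot : Type := {A : set V | exists2 v, M v & A = coset v}.

HB.instance Definition _ := gen_eqMixin subquot.
HB.instance Definition _ := gen_choiceMixin subquot.

Let subquot_inj (p q : subquot) : proj1_sig p = proj1_sig q -> p = q.
Proof.
by move=> e; apply: eq_sig_hprop => // *; exact: Prop_irrelevance.
Qed.

Let inM (v : V) : V := if pselect (M v) then v else 0.

Let inM_mem v : M (inM v).
Proof. by rewrite /inM; case: pselect => //= _; exact: subspace0. Qed.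

Let inM_id v : M v -> inM v = v.
Proof. by rewrite /inM; case: pselect. Qed.

(* The class of [v], meaningful when [v] belongs to [M]. *)
Definition sqpi (v : V) : subquot :=
  exist _ (coset (inM v)) (ex_intro2 _ _ (inM v) (inM_mem v) erefl).

Lemma subquotP (q : subquot) : exists2 v, M v & q = sqpi v.
Proof.
case: q => A hA; case: (hA) => v Mv Av; exists v => //.
by apply: subquot_inj => /=; rewrite inM_id.
Qed.

Lemma sqpi_eq v w : M v -> M w -> sqpi v = sqpi w <-> N (v - w).
Proof.
move=> Mv Mw; split=> [/(congr1 (@proj1_sig _ _))/=|Nvw].
  rewrite !inM_id // => e.
  have : coset w w by split=> //; rewrite subrr; exact: subspace0.
  by rewrite -e => -[].
apply: subquot_inj => /=; rewrite !inM_id //.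
apply/seteqP; split=> x [Mx Nx]; split=> //.
  have -> : w - x = (v - x) - (v - w) by rewrite opprB [RHS]addrC addrA subrK.
  exact: subspaceB.
have -> : v - x = (v - w) + (w - x) by rewrite addrA subrK.
exact: subspaceD.
Qed.

Definition sqrepr (q : subquot) : V := projT1 (cid2 (subquotP q)).

Lemma sqrepr_mem q : M (sqrepr q).
Proof. by rewrite /sqrepr; case: cid2. Qed.

Lemma sqreprK q : sqpi (sqrepr q) = q.
Proof. by rewrite /sqrepr; case: cid2 => v /= _ ->. Qed.

Let sqadd p q := sqpi (sqrepr p + sqrepr q).
Let sqopp p := sqpi (- sqrepr p).
Let sqscale (k : K) p := sqpi (k *: sqrepr p).

Lemma sqreprN v : M v -> N (sqrepr (sqpi v) - v).
Proof.
by move=> Mv; apply/sqpi_eq => //; [exact: sqrepr_mem | rewrite sqreprK].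
Qed.

Let sqaddE v w : M v -> M w -> sqadd (sqpi v) (sqpi w) = sqpi (v + w).
Proof.
move=> Mv Mw; apply/sqpi_eq; try exact: subspaceD.
  by apply: subspaceD; exact: sqrepr_mem.
by rewrite opprD addrACA; apply: subspaceD; exact: sqreprN.
Qed.

Let sqoppE v : M v -> sqopp (sqpi v) = sqpi (- v).
Proof.
move=> Mv; apply/sqpi_eq; try exact: subspaceN.
  by apply: subspaceN; exact: sqrepr_mem.
by rewrite -opprD; apply: subspaceN; exact: sqreprN.
Qed.

Let sqscaleE k v : M v -> sqscale k (sqpi v) = sqpi (k *: v).
Proof.
move=> Mv; apply/sqpi_eq; try exact: subspaceZ.
  by apply: subspaceZ; exact: sqrepr_mem.
by rewrite -scalerBr; apply: subspaceZ; exact: sqreprN.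
Qed.

Let sqaddA : associative sqadd.
Proof.
move=> p q r; have [u Mu ->] := subquotP p; have [v Mv ->] := subquotP q.
have [w Mw ->] := subquotP r.
by rewrite !sqaddE ?addrA //; apply: subspaceD.
Qed.

Let sqaddC : commutative sqadd.
Proof. by move=> p q; rewrite /sqadd addrC. Qed.

Let sqadd0 : left_id (sqpi 0) sqadd.
Proof.
move=> p; have [u Mu ->] := subquotP p.
by rewrite sqaddE ?add0r //; exact: subspace0.
Qed.

Let sqaddN : left_inverse (sqpi 0) sqopp sqadd.
Proof.
move=> p; have [u Mu ->] := subquotP p.
by rewrite sqoppE // sqaddE ?addNr //; exact: subspaceN.
Qed.

HB.instance Definition _ :=
  GRing.isZmodule.Build subquot sqaddA sqaddC sqadd0 sqaddN.

Let sqscaleA k l p : sqscale k (sqscale l p) = sqscale (k * l) p.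
Proof.
have [u Mu ->] := subquotP p.
by rewrite !sqscaleE ?scalerA //; exact: subspaceZ.
Qed.

Let sqscale1 : left_id 1 sqscale.
Proof. by move=> p; have [u Mu ->] := subquotP p; rewrite sqscaleE ?scale1r. Qed.

Let sqscaleDr : right_distributive sqscale +%R.
Proof.
move=> k p q; have [u Mu ->] := subquotP p; have [v Mv ->] := subquotP q.
rewrite /GRing.add /= sqaddE // !sqscaleE ?sqaddE ?scalerDr //;
by [apply: subspaceZ | apply: subspaceD].
Qed.

Let sqscaleDl p : {morph sqscale^~ p : k l / k + l}.
Proof.
move=> k l; have [u Mu ->] := subquotP p.
rewrite [RHS]/GRing.add /= !sqscaleE ?sqaddE ?scalerDl //; exact: subspaceZ.
Qed.

HB.instance Definition _ :=
  GRing.Zmodule_isLmodule.Build K subquot sqscaleA sqscale1 sqscaleDr sqscaleDl.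

Lemma sqpi0 : sqpi 0 = 0 :> subquot. Proof. by []. Qed.

Lemma sqpiD v w : M v -> M w -> sqpi (v + w) = sqpi v + sqpi w.
Proof. by move=> Mv Mw; rewrite [RHS]/GRing.add /= sqaddE. Qed.

Lemma sqpiZ k v : M v -> sqpi (k *: v) = k *: sqpi v.
Proof. by move=> Mv; rewrite [RHS]/GRing.scale /= sqscaleE. Qed.

Lemma sqpi_eq0 v : M v -> sqpi v = 0 <-> N v.
Proof.
by move=> Mv; rewrite -sqpi0 sqpi_eq ?subr0 //; exact: subspace0.
Qed.

End Subquotient.

Section SubquotientMap.
Context (K : fieldType) (V V' : lmodType K).
Context (M N : subspace V) (M' N' : subspace V') (f : {linear V -> V'}).
Context (fM : forall v, M v -> M' (f v)) (fN : forall v, N v -> N' (f v)).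

Let sqfun (q : subquot M N) : subquot M' N' := sqpi M' N' (f (sqrepr q)).

Let sqfunE v : M v -> sqfun (sqpi M N v) = sqpi M' N' (f v).
Proof.
move=> Mv; apply/sqpi_eq; [exact/fM/sqrepr_mem | exact: fM |].
rewrite -linearB; apply: fN; exact: sqreprN.
Qed.

Let sqfun_linear : linear sqfun.
Proof.
move=> k p q; have [u Mu ->] := subquotP p; have [v Mv ->] := subquotP q.
have Mku : M (k *: u) by exact: subspaceZ.
rewrite -sqpiZ // -sqpiD // !sqfunE //; last exact: subspaceD.
by rewrite linearP sqpiD ?sqpiZ //; try apply: subspaceZ; exact: fM.
Qed.

Definition sqmap : {linear subquot M N -> subquot M' N'} :=
  linear_of sqfun_linear.

Lemma sqmapE v : M v -> sqmap (sqpi M N v) = sqpi M' N' (f v).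
Proof. exact: sqfunE. Qed.

End SubquotientMap.

(* The vector space with generators [X] and relations [E]: the free module
   {freeg X / K} modulo the span of [E]. *)
Section Presentation.
Context (K : fieldType) (X : choiceType) (E : {freeg X / K} -> Prop).

Definition presented : lmodType K :=
  subquot (full_subspace {freeg X / K}) (span E).

Definition pclass (x : {freeg X / K}) : presented := sqpi _ _ x.

Definition pgen (x : X) : presented := pclass << x >>.

End Presentation.

Section PresentationMap.
Context (K : fieldType) (X Y : choiceType).
Context (E : {freeg X / K} -> Prop) (E' : {freeg Y / K} -> Prop) (f : X -> Y).

Let fgmap_fun : {freeg X / K} -> {freeg Y / K} := fglift (fun x => << f x >>).

Lemma freeg_ind (P : {freeg X / K} -> Prop) :
  P 0 -> (forall k x D, P D -> P (k *: << x >> + D)) -> forall D, P D.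
Proof.
move=> P0 PS D; rewrite -[D]freeg_sumE.
elim: (dom D) => [|x s IHs]; first by rewrite big_nil.
rewrite big_cons.
have -> : << coeff x D *g x >> = coeff x D *: << x >> :> {freeg X / K}.
  by apply/eqP/freeg_eqP => y; rewrite coeffZ !coeffU mul1r.
exact: PS.
Qed.

Let fgmap_linear : linear fgmap_fun.
Proof.
have fgD : {morph fgmap_fun : x y / x + y}.
  have lB x y : fgmap_fun (x - y) = fgmap_fun x - fgmap_fun y.
    exact: (@lift_is_additive K X _ (fun x => << f x >>)).
  move=> x y.
  have lN z : fgmap_fun (- z) = - fgmap_fun z.
    by rewrite -sub0r lB -(subrr 0) lB subrr sub0r.
  by rewrite -[y in LHS]opprK lB lN opprK.
have fg0 : fgmap_fun 0 = 0.
  by apply: (@addrI _ (fgmap_fun 0)); rewrite -fgD !addr0.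
move=> k u v; rewrite fgD; congr (_ + _).
elim/freeg_ind: u => [|l x D IHD]; first by rewrite !scaler0 fg0 scaler0.
have fgZ c : fgmap_fun (c *: << x >>) = c *: << f x >>.
  have -> : c *: << x >> = << c *g x >> :> {freeg X / K}.
    by apply/eqP/freeg_eqP => y; rewrite coeffZ !coeffU mul1r.
  by rewrite /fgmap_fun liftU.
by rewrite scalerDr !fgD scalerDr IHD scalerA !fgZ scalerA.
Qed.

Definition fgmap : {linear {freeg X / K} -> {freeg Y / K}} :=
  linear_of fgmap_linear.

Lemma fgmapE x : fgmap << x >> = << f x >>.
Proof. by rewrite /= /fgmap_fun liftU scale1r. Qed.

Context (fE : forall e, E e -> span E' (fgmap e)).

Let fspan v : span E v -> span E' (fgmap v).
Proof.
pose N := @Subspace K _ (fun v => span E' (fgmap v)).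
have N0 : span E' (fgmap 0) by rewrite linear0; exact: subspace0.
have NP k u w : span E' (fgmap u) -> span E' (fgmap w) ->
    span E' (fgmap (k *: u + w)) by rewrite linearP; exact: subspaceP.
by move=> /(_ (N N0 NP)); apply.
Qed.

Definition pmap : {linear presented E -> presented E'} :=
  sqmap (M := full_subspace _) (M' := full_subspace _) (fun _ _ => I) fspan.

Lemma pmapE x : pmap (pgen E x) = pgen E' (f x).
Proof. by rewrite /pmap /pgen /pclass sqmapE // fgmapE. Qed.

End PresentationMap.

(* A site whose underlying category is a preordered set of "open sets".  The
   covering families are only assumed to be stable under restriction: sheaves
   are defined by these families themselves, and [locally] below passes to the
   Grothendieck topology they generate (which has the same sheaves) where one is
   needed.  The coverings of X_sa * S are indeed not closed under composition. *)
Record site := Site {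
  site_op :> Type;
  site_le : site_op -> site_op -> Prop;
  site_le_refl : forall U, site_le U U;
  site_le_trans : forall U V W, site_le U V -> site_le V W -> site_le U W;
  site_cov : site_op -> set site_op -> Prop;
  site_cov_le : forall U T V, site_cov U T -> T V -> site_le V U;
  site_cov_restr : forall U T V, site_cov U T -> site_le V U ->
    site_cov V [set W | site_le W V /\ exists2 W', T W' & site_le W W'] }.

Arguments site_le {s}.
Arguments site_cov {s}.

Notation "U <=o V" := (site_le U V) (at level 70, no associativity).

(* [locally P U]: [U] is covered, in the Grothendieck topology generated by the
   covering families, by opens satisfying [P]. *)
Inductive locally (C : site) (P : C -> Prop) : C -> Prop :=
| locally_here U : P U -> locally P U
| locally_cov U T : site_cov U T -> (forall V, T V -> locally P V) ->
    locally P U.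

Definition down_closed (C : site) (P : C -> Prop) :=
  forall U V, V <=o U -> P U -> P V.

Section Locally.
Context (C : site).
Implicit Types (P Q : C -> Prop) (U V : C).

Lemma locally_le P U V : down_closed P -> locally P U -> V <=o U -> locally P V.
Proof.
move=> dP lU; elim: lU V => [{}U PU|{}U T UT _ IH] V VU.
  by apply: locally_here; exact: dP PU.
apply: (locally_cov (site_cov_restr UT VU)) => W [_ [W' TW' WW']].
exact: IH WW'.
Qed.

Lemma locally_down P : down_closed P -> down_closed (locally P).
Proof. by move=> dP U V VU lU; exact: locally_le lU VU. Qed.

Lemma locally_sub P Q U : (forall V, P V -> Q V) -> locally P U -> locally Q U.
Proof.
move=> PQ; elim=> [{}U PU|{}U T UT _ IH]; first exact/locally_here/PQ.
exact: locally_cov UT IH.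
Qed.

Lemma locally_and P Q U : down_closed P -> down_closed Q ->
  locally P U -> locally Q U -> locally (fun V => P V /\ Q V) U.
Proof.
move=> dP dQ; elim=> [{}U PU|{}U T UT _ IH] lQ; last first.
  apply: (locally_cov UT) => V TV; apply: IH => //.
  by apply: locally_le lQ _ => //; exact: site_cov_le TV.
elim: lQ PU => [{}U QU|{}U T UT _ IH] PU; first exact: locally_here.
apply: (locally_cov UT) => V TV; apply: IH => //.
by apply: dP PU; exact: site_cov_le TV.
Qed.

Lemma locally_below U : locally (fun V => V <=o U) U.
Proof. exact/locally_here/site_le_refl. Qed.

Lemma below_down U : down_closed (fun V => V <=o U).
Proof. by move=> V W WV VU; exact: site_le_trans VU. Qed.

Lemma locally_idem P U : locally (locally P) U -> locally P U.
Proof. by elim=> // {}U T UT _ IH; exact: locally_cov UT IH. Qed.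

End Locally.

Record presheaf (K : fieldType) (C : site) := Presheaf {
  psec :> C -> lmodType K;
  res : forall U V, V <=o U -> {linear psec U -> psec V};
  res_id : forall U (h : U <=o U) (s : psec U), res h s = s;
  res_comp : forall U V W (h : V <=o U) (h' : W <=o V) (h'' : W <=o U)
    (s : psec U), res h' (res h s) = res h'' s }.

Record pmor (K : fieldType) (C : site) (F G : presheaf K C) := Pmor {
  pmor_app :> forall U, {linear F U -> G U};
  pmor_nat : forall U V (h : V <=o U) s,
    res G h (pmor_app U s) = pmor_app V (res F h s) }.

Definition pmor_eq (K : fieldType) (C : site) (F G : presheaf K C)
  (f g : pmor F G) := forall U s, f U s = g U s.

Section PresheafMorphisms.
Context (K : fieldType) (C : site).

Definition pmor_id (F : presheaf K C) : pmor F F :=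
  @Pmor K C F F (fun U => idlin (F U)) (fun _ _ _ _ => erefl).

Lemma linear_comp (U V W : lmodType K) (f : {linear V -> W})
  (g : {linear U -> V}) : linear (fun x => f (g x)).
Proof. by move=> k u v; rewrite !linearP. Qed.

Lemma pmor_comp_subproof (F G H : presheaf K C) (g : pmor G H) (f : pmor F G) :
  forall U V (h : V <=o U) s,
    res H h (linear_of (linear_comp (g U) (f U)) s) =
    linear_of (linear_comp (g V) (f V)) (res F h s).
Proof. by move=> U V h s /=; rewrite !pmor_nat. Qed.

Definition pmor_comp (F G H : presheaf K C) (g : pmor G H) (f : pmor F G) :
  pmor F H := Pmor (pmor_comp_subproof g f).

End PresheafMorphisms.

(* The covering condition on overlaps quantifies over all opens contained in
   two members of the family, which amounts to their intersection when the site
   has intersections. *)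
Definition is_sheaf (K : fieldType) (C : site) (F : presheaf K C) :=
  forall U (T : set C), site_cov U T ->
    (forall s t : F U,
       (forall V (h : V <=o U), T V -> res F h s = res F h t) -> s = t) /\
    (forall fam : (forall V, F V),
       (forall V V' W (h : W <=o V) (h' : W <=o V'), T V -> T V' ->
          res F h (fam V) = res F h' (fam V')) ->
       exists s : F U, forall V (h : V <=o U), T V -> res F h s = fam V).

Record sheaf (K : fieldType) (C : site) := Sheaf {
  sheaf_presheaf :> presheaf K C;
  sheafP : is_sheaf sheaf_presheaf }.

(* The presheaf P^+ : U |-> colim_J lim_(V in J) P V, the colimit being over the
   covering sieves J of U.  An element is represented by a family [s] of
   sections over all opens which is a matching family on some covering sieve
   (i.e. on the sieve of all [V] such that [coherent_at s V]); two such
   families are identified when they agree on a covering sieve. *)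
Section Plus.
Context (K : fieldType) (C : site) (P : presheaf K C).

Definition coherent_at (s : dprod P) (V : C) : Prop :=
  forall W (h : W <=o V), s W = res P h (s V).

Definition zero_below (s : dprod P) (V : C) : Prop :=
  forall W, W <=o V -> s W = 0.

Lemma coherent_at_down (s : dprod P) : down_closed (coherent_at s).
Proof.
move=> U V VU cU W WV; rewrite (cU _ VU) (cU _ (site_le_trans WV VU)).
by rewrite (res_comp _ _ (site_le_trans WV VU)).
Qed.

Lemma zero_below_down (s : dprod P) : down_closed (zero_below s).
Proof. by move=> U V VU zU W WV; apply: zU; exact: site_le_trans VU. Qed.

Lemma dprodP k (s t : dprod P) W : (k *: s + t) W = k *: s W + t W.
Proof. by []. Qed.

Lemma dprodB (s t : dprod P) W : (s - t) W = s W - t W.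
Proof. by []. Qed.

Definition matching (U : C) : subspace (dprod P).
Proof.
refine (@Subspace K (dprod P) (fun s => locally (coherent_at s) U) _ _).
  by apply: locally_here => W h; rewrite linear0.
move=> k s t ls lt.
have := locally_and (@coherent_at_down s) (@coherent_at_down t) ls lt.
by apply: locally_sub => V [cs ct] W h; rewrite !dprodP linearP -cs -ct.
Defined.

Definition vanishing (U : C) : subspace (dprod P).
Proof.
refine (@Subspace K (dprod P) (fun s => locally (zero_below s) U) _ _).
  exact: locally_here.
move=> k s t ls lt.
have := locally_and (@zero_below_down s) (@zero_below_down t) ls lt.
apply: locally_sub => V [cs ct] W h.
by rewrite dprodP cs // ct // scaler0 addr0.
Defined.

Definition plus_sec (U : C) : lmodType K := subquot (matching U) (vanishing U).

Lemma matching_le U V (h : V <=o U) (s : dprod P) : matching U s -> matching V (idlin _ s).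
Proof. by move=> ms; apply: locally_le h => //; exact: coherent_at_down. Qed.

Lemma vanishing_le U V (h : V <=o U) (s : dprod P) :
  vanishing U s -> vanishing V (idlin _ s).
Proof. by move=> ms; apply: locally_le h => //; exact: zero_below_down. Qed.

Definition plus_res U V (h : V <=o U) : {linear plus_sec U -> plus_sec V} :=
  sqmap (matching_le h) (vanishing_le h).

Lemma plus_resE U V (h : V <=o U) s : matching U s ->
  plus_res h (sqpi _ _ s) = sqpi _ _ s.
Proof. by move=> ms; rewrite /plus_res sqmapE. Qed.

Lemma plus_res_id U (h : U <=o U) s : plus_res h s = s.
Proof. by have [v Mv ->] := subquotP s; rewrite plus_resE. Qed.

Lemma plus_res_comp U V W (h : V <=o U) (h' : W <=o V) (h'' : W <=o U) s :
  plus_res h' (plus_res h s) = plus_res h'' s.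
Proof.
have [v Mv ->] := subquotP s; rewrite !plus_resE //.
exact: (matching_le h Mv).
Qed.

Definition plus : presheaf K C := Presheaf plus_res_id plus_res_comp.

(* The family of all the restrictions of [s], extended by zero. *)
Definition restrictions U (s : P U) : dprod P :=
  fun V => if pselect (V <=o U) is left h then res P h s else 0.

Lemma restrictionsE U (s : P U) V (h : V <=o U) : restrictions s V = res P h s.
Proof.
rewrite /restrictions; case: pselect => // h'.
by rewrite (Prop_irrelevance h' h).
Qed.

Lemma restrictions_mem U (s : P U) : matching U (restrictions s).
Proof.
apply: locally_here => W h.
rewrite (restrictionsE _ h) (restrictionsE _ (site_le_refl U)).
by rewrite (res_comp _ _ h).
Qed.

Lemma restrictions_linear U : linear (@restrictions U : P U -> dprod P).
Proof.
move=> k s t; apply: functional_extensionality_dep => V; rewrite dprodP.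
rewrite /restrictions; case: pselect => [h|_]; first by rewrite linearP.
by rewrite scaler0 addr0.
Qed.

Lemma plus_unit_linear U :
  linear (fun s : P U => sqpi (matching U) (vanishing U) (restrictions s)).
Proof.
move=> k s t; rewrite restrictions_linear.
have mem := @restrictions_mem U.
by rewrite sqpiD ?sqpiZ //; apply: subspaceZ; exact: mem.
Qed.

Lemma plus_unit_nat U V (h : V <=o U) (s : P U) :
  res plus h (linear_of (@plus_unit_linear U) s) =
  linear_of (@plus_unit_linear V) (res P h s).
Proof.
apply: etrans (plus_resE h (restrictions_mem s)) _.
apply/sqpi_eq; [exact/(matching_le h)/restrictions_mem
               | exact: restrictions_mem |].
apply: locally_here => W WV; rewrite dprodB (restrictionsE _ WV).
rewrite (restrictionsE _ (site_le_trans WV h)).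
by rewrite (res_comp _ _ (site_le_trans WV h)) subrr.
Qed.

Definition plus_unit : pmor P plus := Pmor plus_unit_nat.

Definition locally_zero (F : presheaf K C) U (s : F U) : Prop :=
  locally (fun V => exists h : V <=o U, res F h s = 0) U.

Definition separated (F : presheaf K C) :=
  forall U (s : F U), locally_zero s -> s = 0.

End Plus.

Section PlusSheaf.
Context (K : fieldType) (C : site) (P : presheaf K C).

Lemma plus_separated : separated (plus P).
Proof.
move=> U q; have [s Ms ->] := subquotP q => lz.
apply/sqpi_eq0 => //; apply: locally_idem; apply: locally_sub lz => V [h].
by rewrite [res _ _ _](plus_resE h Ms) => /sqpi_eq0; apply; exact: (matching_le h Ms).
Qed.

Lemma separated_cov (F : presheaf K C) U T (s t : F U) : separated F ->
  site_cov U T -> (forall V (h : V <=o U), T V -> res F h s = res F h t) ->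
  s = t.
Proof.
move=> sF UT st; apply/eqP; rewrite -subr_eq0; apply/eqP/sF.
apply: (locally_cov UT) => V TV; apply: locally_here.
have h := site_cov_le UT TV; exists h.
by rewrite linearB (st _ h) ?subrr.
Qed.

Lemma plus_sheaf : separated P -> is_sheaf (plus P).
Proof.
move=> sP U T UT; split=> [s t|fam famE].
  by apply: separated_cov => //; exact: plus_separated.
pose f V : dprod P := sqrepr (fam V).
have fM V : matching P V (f V) by exact: sqrepr_mem.
have agree V V' W : T V -> T V' -> W <=o V -> W <=o V' ->
    coherent_at (f V) W -> coherent_at (f V') W -> f V W = f V' W.
  move=> TV TV' WV WV' cV cV'; apply/eqP; rewrite -subr_eq0; apply/eqP/sP.
  have := famE _ _ _ WV WV' TV TV'.
  rewrite -(sqreprK (fam V)) -(sqreprK (fam V')).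
  rewrite [LHS](plus_resE WV (fM V)) [RHS](plus_resE WV' (fM V')).
  move/sqpi_eq => /(_ (matching_le WV (fM V)) (matching_le WV' (fM V'))).
  move=> lz; rewrite /locally_zero.
  have := locally_and (@zero_below_down _ _ P _) (@below_down _ W) lz
    (locally_below W).
  apply: locally_sub => X [z h]; exists h.
  by rewrite linearB -cV -cV' -[LHS]/((f V - f V') X) z //; exact: site_le_refl.
pose good W V := [/\ T V, W <=o V & coherent_at (f V) W].
pose s : dprod P := fun W =>
  if pselect (exists V, good W V) is left e then f (projT1 (cid e)) W else 0.
have sE V W : good W V -> s W = f V W.
  move=> gV; rewrite /s; case: pselect => [e|]; last by case; exists V.
  case: (cid e) => V' [TV' WV' cV'] /=; case: gV => TV WV cV.
  exact: agree.
have goodD W V X : good W V -> X <=o W -> good X V.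
  move=> [TV WV cV] XW; split=> //; first exact: site_le_trans WV.
  exact: coherent_at_down cV.
have lgood V : T V -> locally (fun W => good W V) V.
  move=> TV; have := locally_and (@coherent_at_down _ _ P _)
    (@below_down _ V) (fM V) (locally_below V).
  by apply: locally_sub => W [].
have sM : matching P U s.
  apply: (locally_cov UT) => V TV; apply: locally_sub (lgood V TV) => W gW X XW.
  rewrite (sE V W gW) (sE V X (goodD _ _ _ gW XW)).
  by case: gW => _ _; apply.
exists (sqpi _ _ s) => V h TV; rewrite [LHS](plus_resE h sM) -(sqreprK (fam V)).
apply/sqpi_eq; [exact: (matching_le h sM) | exact: fM |].
apply: locally_sub (lgood V TV) => W gW X XW.
by rewrite dprodB (sE V X (goodD _ _ _ gW XW)) subrr.
Qed.




End PlusSheaf.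

Section PlusMap.
Context (K : fieldType) (C : site) (P Q : presheaf K C) (f : pmor P Q).

Let F : {linear dprod P -> dprod Q} := dprod_map f.

Lemma plus_map_matching U s : matching P U s -> matching Q U (F s).
Proof.
by apply: locally_sub => V cV W h /=; rewrite (cV W h) pmor_nat.
Qed.

Lemma plus_map_vanishing U s : vanishing P U s -> vanishing Q U (F s).
Proof.
by apply: locally_sub => V zV W h /=; rewrite (zV W h) linear0.
Qed.

Definition plus_map_app U : {linear plus P U -> plus Q U} :=
  sqmap (@plus_map_matching U) (@plus_map_vanishing U).

Lemma plus_map_appE U s : matching P U s ->
  plus_map_app U (sqpi _ _ s) = sqpi _ _ (F s).
Proof. by move=> Ms; rewrite /plus_map_app sqmapE. Qed.

Lemma plus_map_nat U V (h : V <=o U) s :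
  res (plus Q) h (plus_map_app U s) = plus_map_app V (res (plus P) h s).
Proof.
have [v Mv ->] := subquotP s.
rewrite (plus_map_appE Mv) [LHS](plus_resE h (plus_map_matching Mv)).
rewrite [res _ _ _](plus_resE h Mv) (plus_map_appE (matching_le h Mv)).
by [].
Qed.

Definition plus_map : pmor (plus P) (plus Q) := Pmor plus_map_nat.

End PlusMap.

Section PlusMapTheory.
Context (K : fieldType) (C : site).

Lemma plus_map_ext (P Q : presheaf K C) (f g : pmor P Q) :
  pmor_eq f g -> pmor_eq (plus_map f) (plus_map g).
Proof.
move=> fg U s; have [v Mv ->] := subquotP s.
rewrite [LHS](plus_map_appE f Mv) [RHS](plus_map_appE g Mv).
by congr sqpi; apply: functional_extensionality_dep => V; exact: fg.
Qed.

Lemma plus_map_id (P : presheaf K C) :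
  pmor_eq (plus_map (pmor_id P)) (pmor_id (plus P)).
Proof.
move=> U s; have [v Mv ->] := subquotP s.
by rewrite [LHS](plus_map_appE (pmor_id P) Mv).
Qed.

Lemma plus_map_comp (P Q H : presheaf K C) (g : pmor Q H) (f : pmor P Q) :
  pmor_eq (plus_map (pmor_comp g f)) (pmor_comp (plus_map g) (plus_map f)).
Proof.
move=> U s; have [v Mv ->] := subquotP s.
apply: etrans (plus_map_appE (pmor_comp g f) Mv) (esym _).
apply: etrans (congr1 (plus_map_app g U) (plus_map_appE f Mv)) _.
exact: (plus_map_appE g (plus_map_matching f Mv)).
Qed.

End PlusMapTheory.

Section Sheafification.
Context (K : fieldType) (C : site).

Definition sheafify (P : presheaf K C) : sheaf K C :=
  Sheaf (plus_sheaf (@plus_separated K C P)).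

Definition sheafify_unit (P : presheaf K C) : pmor P (sheafify P) :=
  pmor_comp (plus_unit (plus P)) (plus_unit P).

Definition sheafify_map (P Q : presheaf K C) (f : pmor P Q) :
  pmor (sheafify P) (sheafify Q) := plus_map (plus_map f).

Lemma sheafify_map_ext (P Q : presheaf K C) (f g : pmor P Q) :
  pmor_eq f g -> pmor_eq (sheafify_map f) (sheafify_map g).
Proof. by move=> fg; do 2!apply: plus_map_ext. Qed.

Lemma sheafify_map_id (P : presheaf K C) :
  pmor_eq (sheafify_map (pmor_id P)) (pmor_id (sheafify P)).
Proof.
move=> U s; rewrite -[RHS](plus_map_id s); apply: plus_map_ext.
exact: plus_map_id.
Qed.

Lemma sheafify_map_comp (P Q H : presheaf K C) (g : pmor Q H) (f : pmor P Q) :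
  pmor_eq (sheafify_map (pmor_comp g f))
    (pmor_comp (sheafify_map g) (sheafify_map f)).
Proof.
move=> U s; rewrite -[RHS](plus_map_comp _ _ s); apply: plus_map_ext.
exact: plus_map_comp.
Qed.

End Sheafification.

Record sheaf_functor (K : fieldType) (C D : site) := SheafFunctor {
  sf_obj :> sheaf K C -> sheaf K D;
  sf_mor : forall F G : sheaf K C, pmor F G -> pmor (sf_obj F) (sf_obj G);
  sf_ext : forall (F G : sheaf K C) (f g : pmor F G),
    pmor_eq f g -> pmor_eq (sf_mor f) (sf_mor g);
  sf_id : forall F : sheaf K C,
    pmor_eq (sf_mor (pmor_id F)) (pmor_id (sf_obj F));
  sf_comp : forall (F G H : sheaf K C) (g : pmor G H) (f : pmor F G),
    pmor_eq (sf_mor (pmor_comp g f)) (pmor_comp (sf_mor g) (sf_mor f)) }.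

Record adjunction (K : fieldType) (C D : site)
    (L : sheaf_functor K C D) (R : sheaf_functor K D C) := Adjunction {
  adj_unit : forall G : sheaf K C, pmor G (R (L G));
  adj_counit : forall F : sheaf K D, pmor (L (R F)) F;
  adj_unit_nat : forall (G G' : sheaf K C) (g : pmor G G'),
    pmor_eq (pmor_comp (adj_unit G') g)
            (pmor_comp (sf_mor R (sf_mor L g)) (adj_unit G));
  adj_counit_nat : forall (F F' : sheaf K D) (f : pmor F F'),
    pmor_eq (pmor_comp f (adj_counit F))
            (pmor_comp (adj_counit F') (sf_mor L (sf_mor R f)));
  adj_triangleL : forall G : sheaf K C,
    pmor_eq (pmor_comp (adj_counit (L G)) (sf_mor L (adj_unit G)))
            (pmor_id (L G));
  adj_triangleR : forall F : sheaf K D,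
    pmor_eq (pmor_comp (sf_mor R (adj_counit F)) (adj_unit (R F)))
            (pmor_id (R F)) }.

Section Exactness.
Context (K : fieldType) (C : site).

Definition sheaf_mono (F G : sheaf K C) (f : pmor F G) :=
  forall U (s : F U), f U s = 0 -> s = 0.

(* [t] belongs to the image sheaf of [f]. *)
Definition in_image (F G : sheaf K C) (f : pmor F G) (U : C) (t : G U) :=
  locally (fun V => exists (h : V <=o U) (s : F V), f V s = res G h t) U.

Definition sheaf_epi (F G : sheaf K C) (f : pmor F G) :=
  forall U (t : G U), in_image f t.

Definition short_exact (F G H : sheaf K C) (f : pmor F G) (g : pmor G H) :=
  [/\ sheaf_mono f, sheaf_epi g &
      forall U (t : G U), g U t = 0 <-> in_image f t].

Definition sheaf_iso (F G : sheaf K C) (f : pmor F G) :=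
  exists g : pmor G F,
    pmor_eq (pmor_comp g f) (pmor_id F) /\ pmor_eq (pmor_comp f g) (pmor_id G).

End Exactness.

Definition exact_functor (K : fieldType) (C D : site)
    (L : sheaf_functor K C D) :=
  forall (F G H : sheaf K C) (f : pmor F G) (g : pmor G H),
    short_exact f g -> short_exact (sf_mor L f) (sf_mor L g).

Section PresentedTheory.
Context (K : fieldType) (X : choiceType) (E : {freeg X / K} -> Prop).

Lemma presented_ext (V : lmodType K) (f g : {linear presented E -> V}) :
  (forall x, f (pgen E x) = g (pgen E x)) -> forall q, f q = g q.
Proof.
move=> fg q; have [v _ ->] := subquotP q.
elim/freeg_ind: v => [|k x D IHD]; first by rewrite sqpi0 !linear0.
by rewrite sqpiD // sqpiZ // !linearP IHD -/(pclass _ _) -/(pgen _ _) fg.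
Qed.

Lemma presented_ext_comp (B V : lmodType K) (f : {linear presented E -> B})
    (g : {linear B -> V}) (h : {linear presented E -> V}) :
  (forall x, g (f (pgen E x)) = h (pgen E x)) -> forall q, g (f q) = h q.
Proof.
move=> gf q; apply: (presented_ext (f := linear_of (linear_comp g f)) (g := h)).
exact: gf.
Qed.

Lemma presented_ext_square (B B' V : lmodType K)
    (f : {linear presented E -> B}) (g : {linear B -> V})
    (f' : {linear presented E -> B'}) (g' : {linear B' -> V}) :
  (forall x, g (f (pgen E x)) = g' (f' (pgen E x))) ->
  forall q, g (f q) = g' (f' q).
Proof.
move=> gf; apply: (presented_ext_comp (h := linear_of (linear_comp g' f'))).
exact: gf.
Qed.

Lemma pclass_eq (a b : {freeg X / K}) : E (a - b) -> pclass E a = pclass E b.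
Proof. by move=> Eab; apply/sqpi_eq => //; exact: span_gen. Qed.

End PresentedTheory.

Section PresentationMapTheory.
Context (K : fieldType) (X Y Y' Z : choiceType).
Context (E : {freeg X / K} -> Prop) (E1 : {freeg Y / K} -> Prop).
Context (E1' : {freeg Y' / K} -> Prop) (E2 : {freeg Z / K} -> Prop).

Lemma pmap_eq (f g : X -> Y) (fE : forall e, E e -> span E1 (fgmap K f e))
    (gE : forall e, E e -> span E1 (fgmap K g e)) :
  f =1 g -> forall q, pmap fE q = pmap gE q.
Proof. by move=> fg; apply: presented_ext => x; rewrite !pmapE fg. Qed.

Lemma pmap_id (f : X -> X) (fE : forall e, E e -> span E (fgmap K f e)) :
  f =1 id -> forall q, pmap fE q = q.
Proof.
move=> f1 q; apply: (presented_ext (f := pmap fE) (g := idlin _)) => x.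
by rewrite pmapE f1.
Qed.

Lemma pmap_comp (f : X -> Y) (g : Y -> Z) (h : X -> Z)
    (fE : forall e, E e -> span E1 (fgmap K f e))
    (gE : forall e, E1 e -> span E2 (fgmap K g e))
    (hE : forall e, E e -> span E2 (fgmap K h e)) :
  (forall x, g (f x) = h x) -> forall q, pmap gE (pmap fE q) = pmap hE q.
Proof.
move=> gf; apply: presented_ext_comp => x.
by rewrite (pmapE fE) (pmapE gE) (pmapE hE) gf.
Qed.

Lemma pmap_square (f : X -> Y) (g : Y -> Z) (f' : X -> Y') (g' : Y' -> Z)
    (fE : forall e, E e -> span E1 (fgmap K f e))
    (gE : forall e, E1 e -> span E2 (fgmap K g e))
    (fE' : forall e, E e -> span E1' (fgmap K f' e))
    (gE' : forall e, E1' e -> span E2 (fgmap K g' e)) :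
  (forall x, g (f x) = g' (f' x)) ->
  forall q, pmap gE (pmap fE q) = pmap gE' (pmap fE' q).
Proof.
move=> gf; apply: presented_ext_square => x.
by rewrite (pmapE fE) (pmapE gE) (pmapE fE') (pmapE gE') gf.
Qed.

End PresentationMapTheory.

Section Tensor.
Context (K : fieldType) (V W : lmodType K).

Inductive tensor_rel : {freeg (V * W)%type / K} -> Prop :=
| tensor_rel_l k v v' w :
    tensor_rel (<< (k *: v + v', w) >> - (k *: << (v, w) >> + << (v', w) >>))
| tensor_rel_r k v w w' :
    tensor_rel (<< (v, k *: w + w') >> - (k *: << (v, w) >> + << (v, w') >>)).

Definition tensor : lmodType K := presented tensor_rel.

Definition pure_tensor (v : V) (w : W) : tensor := pgen tensor_rel (v, w).

End Tensor.

Section TensorMap.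
Context (K : fieldType) (V W V' W' : lmodType K).
Context (f : {linear V -> V'}) (g : {linear W -> W'}).

Definition pair_map (p : V * W) : V' * W' := (f p.1, g p.2).

Lemma pair_map_rel e : @tensor_rel K V W e -> span (@tensor_rel K V' W') (fgmap K pair_map e).
Proof.
case=> [k v v' w|k v w w'].
  rewrite linearB linearP.
  rewrite !fgmapE.
  rewrite /pair_map /=.
  rewrite (linearP f).
  apply: span_gen.
  exact: tensor_rel_l.
rewrite linearB linearP !fgmapE.
rewrite /pair_map /=.
rewrite (linearP g).
apply: span_gen.
exact: tensor_rel_r.
Qed.

Definition tensor_map : {linear tensor V W -> tensor V' W'} := pmap pair_map_rel.

Lemma tensor_mapE v w :
  tensor_map (pure_tensor v w) = pure_tensor (f v) (g w).
Proof. exact: pmapE. Qed.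

End TensorMap.

Section TensorSheaf.
Context (K : fieldType) (C : site).

Section PresheafTensor.
Context (F G : presheaf K C).

Let ptensor_res U V (h : V <=o U) :
  {linear tensor (F U) (G U) -> tensor (F V) (G V)} :=
  tensor_map (res F h) (res G h).

Let ptensor_res_id U (h : U <=o U) s : ptensor_res h s = s.
Proof.
by apply: pmap_id => -[v w]; rewrite /pair_map !res_id.
Qed.

Let ptensor_res_comp U V W (h : V <=o U) (h' : W <=o V) (h'' : W <=o U) s :
  ptensor_res h' (ptensor_res h s) = ptensor_res h'' s.
Proof.
by apply: pmap_comp => -[v w]; rewrite /pair_map !(res_comp _ _ h'').
Qed.

Definition presheaf_tensor : presheaf K C :=
  Presheaf ptensor_res_id ptensor_res_comp.

End PresheafTensor.

Section PresheafTensorMap.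
Context (F F' G G' : presheaf K C) (f : pmor F F') (g : pmor G G').

Let ptensor_app U : {linear presheaf_tensor F G U -> presheaf_tensor F' G' U} :=
  tensor_map (f U) (g U).

Let ptensor_nat U V (h : V <=o U) s :
  res (presheaf_tensor F' G') h (ptensor_app U s) =
  ptensor_app V (res (presheaf_tensor F G) h s).
Proof.
by apply: pmap_square => -[v w]; rewrite /pair_map /= !pmor_nat.
Qed.

Definition presheaf_tensor_map :
  pmor (presheaf_tensor F G) (presheaf_tensor F' G') := Pmor ptensor_nat.

End PresheafTensorMap.

Definition sheaf_tensor (F G : sheaf K C) : sheaf K C :=
  sheafify (presheaf_tensor F G).

Definition sheaf_tensor_map (F F' G G' : sheaf K C) (f : pmor F F')
    (g : pmor G G') : pmor (sheaf_tensor F G) (sheaf_tensor F' G') :=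
  sheafify_map (presheaf_tensor_map f g).

Definition tensor_section (F G : sheaf K C) U (s : F U) (t : G U) :
  sheaf_tensor F G U := sheafify_unit (presheaf_tensor F G) U (pure_tensor s t).

End TensorSheaf.

(* A morphism of sites D -> C is a functor from the opens of C to the opens
   of D that preserves coverings. *)
Record site_morphism (D C : site) := SiteMorphism {
  sm_op :> C -> D;
  sm_mono : forall U V, U <=o V -> sm_op U <=o sm_op V;
  sm_cov : forall U T, site_cov U T -> site_cov (sm_op U) (sm_op @` T) }.

Section InverseImage.
Context (K : fieldType) (D C : site) (u : site_morphism D C).

Record nbhd_section (F : presheaf K C) (O : D) := NbhdSection {
  ns_op : C;
  ns_le : O <=o u ns_op;
  ns_sec : F ns_op }.

HB.instance Definition _ F O := gen_eqMixin (nbhd_section F O).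
HB.instance Definition _ F O := gen_choiceMixin (nbhd_section F O).

Section PresheafInverseImage.
Context (F : presheaf K C).

(* Generators and relations for colim_(O <= u W) F W. *)
Inductive nbhd_rel (O : D) : {freeg (nbhd_section F O) / K} -> Prop :=
| nbhd_rel_linear W (h : O <=o u W) k (s t : F W) :
    nbhd_rel (<< NbhdSection h (k *: s + t) >> -
              (k *: << NbhdSection h s >> + << NbhdSection h t >>))
| nbhd_rel_res W W' (h : O <=o u W) (h' : O <=o u W') (l : W' <=o W) (s : F W) :
    nbhd_rel (<< NbhdSection h s >> - << NbhdSection h' (res F l s) >>).

Definition nbhd_colim (O : D) : lmodType K := presented (@nbhd_rel O).

Let shrink O O' (l : O' <=o O) (x : nbhd_section F O) : nbhd_section F O' :=
  NbhdSection (site_le_trans l (ns_le x)) (ns_sec x).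

Let shrink_rel O O' (l : O' <=o O) e :
  @nbhd_rel O e -> span (@nbhd_rel O') (fgmap K (shrink l) e).
Proof.
case=> [W h k s t|W W' h h' m s].
  rewrite linearB linearP !fgmapE.
  apply: span_gen.
  exact: nbhd_rel_linear.
rewrite linearB !fgmapE.
apply: span_gen.
exact: nbhd_rel_res.
Qed.

Let nbhd_res O O' (l : O' <=o O) : {linear nbhd_colim O -> nbhd_colim O'} :=
  pmap (shrink_rel l).

Let nbhd_res_id O (h : O <=o O) s : nbhd_res h s = s.
Proof.
apply: pmap_id => -[W l a]; rewrite /shrink /=; congr NbhdSection.
exact: Prop_irrelevance.
Qed.

Let nbhd_res_comp U V W (h : V <=o U) (h' : W <=o V) (h'' : W <=o U) s :
  nbhd_res h' (nbhd_res h s) = nbhd_res h'' s.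
Proof.
apply: pmap_comp => -[W0 l a]; rewrite /shrink /=; congr NbhdSection.
exact: Prop_irrelevance.
Qed.

Definition presheaf_inverse_image : presheaf K D :=
  Presheaf nbhd_res_id nbhd_res_comp.

End PresheafInverseImage.

Section PresheafInverseImageMap.
Context (F G : presheaf K C) (f : pmor F G).

Definition push O (x : nbhd_section F O) : nbhd_section G O :=
  NbhdSection (ns_le x) (f _ (ns_sec x)).

Let push_rel O e :
  @nbhd_rel F O e -> span (@nbhd_rel G O) (fgmap K (@push O) e).
Proof.
case=> [W h k s t|W W' h h' m s].
  rewrite linearB linearP !fgmapE.
  have -> : push (NbhdSection h (k *: s + t)) =
      NbhdSection h (k *: f W s + f W t) by rewrite /push /= linearP.
  apply: span_gen.
  exact: nbhd_rel_linear.
rewrite linearB !fgmapE.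
have -> : push (NbhdSection h' (res F m s)) =
    NbhdSection h' (res G m (f W s)) by rewrite /push /= pmor_nat.
apply: span_gen.
exact: nbhd_rel_res.
Qed.

Let push_app O :
  {linear presheaf_inverse_image F O -> presheaf_inverse_image G O} :=
  pmap (@push_rel O).

Let push_nat O O' (h : O' <=o O) s :
  res (presheaf_inverse_image G) h (push_app O s) =
  push_app O' (res (presheaf_inverse_image F) h s).
Proof.
by apply: pmap_square.
Qed.

Definition presheaf_inverse_image_map :
  pmor (presheaf_inverse_image F) (presheaf_inverse_image G) := Pmor push_nat.

Lemma presheaf_inverse_image_mapE O W (h : O <=o u W) (s : F W) :
  presheaf_inverse_image_map O (pgen _ (NbhdSection h s)) =
  pgen _ (NbhdSection h (f W s)).
Proof. exact: pmapE. Qed.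

End PresheafInverseImageMap.

Let inv_obj (F : sheaf K C) : sheaf K D := sheafify (presheaf_inverse_image F).

Let inv_mor (F G : sheaf K C) (f : pmor F G) : pmor (inv_obj F) (inv_obj G) :=
  sheafify_map (presheaf_inverse_image_map f).

Let inv_ext (F G : sheaf K C) (f g : pmor F G) :
  pmor_eq f g -> pmor_eq (inv_mor f) (inv_mor g).
Proof.
move=> fg; apply: sheafify_map_ext => O; apply: pmap_eq => -[W h s].
by rewrite /push fg.
Qed.

Let inv_id (F : sheaf K C) : pmor_eq (inv_mor (pmor_id F)) (pmor_id (inv_obj F)).
Proof.
move=> O s; rewrite -[RHS](sheafify_map_id s); apply: sheafify_map_ext => V.
by move=> t; apply: pmap_id => -[].
Qed.

Let inv_comp (F G H : sheaf K C) (g : pmor G H) (f : pmor F G) :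
  pmor_eq (inv_mor (pmor_comp g f)) (pmor_comp (inv_mor g) (inv_mor f)).
Proof.
move=> O s; rewrite -[RHS](sheafify_map_comp _ _ s); apply: sheafify_map_ext => V.
by move=> t; apply/esym; apply: pmap_comp => -[].
Qed.

Definition inverse_image : sheaf_functor K C D :=
  SheafFunctor inv_ext inv_id inv_comp.

(* The section over [O] of the inverse image of [F] defined by a section of [F]
   over a neighbourhood of [O]. *)
Definition inverse_section (F : sheaf K C) O W (h : O <=o u W) (s : F W) :
  inverse_image F O :=
  sheafify_unit (presheaf_inverse_image F) O (pgen _ (NbhdSection h s)).

End InverseImage.

(* A left adjoint [L] of the inverse image functor commutes with tensor products:
   the canonical morphism L (F \otimes G) -> L F \otimes L G is an isomorphism.
   This morphism is the one adjoint to
     F \otimes G -> u^-1 L F \otimes u^-1 L G = u^-1 (L F \otimes L G);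
   the last clause says so on sections, writing the images under the unit of
   sections [s] of F and [t] of G as coming from sections [a] of L F and
   [b] of L G (which is always possible locally). *)
Definition commutes_with_tensor (K : fieldType) (D C : site)
    (u : site_morphism D C) (L : sheaf_functor K D C)
    (adj : adjunction L (inverse_image K u)) :=
  exists theta : forall F G : sheaf K D,
      pmor (L (sheaf_tensor F G)) (sheaf_tensor (L F) (L G)),
    [/\ forall F G, sheaf_iso (theta F G),
        forall (F F' G G' : sheaf K D) (f : pmor F F') (g : pmor G G'),
          pmor_eq
            (pmor_comp (theta F' G') (sf_mor L (sheaf_tensor_map f g)))
            (pmor_comp (sheaf_tensor_map (sf_mor L f) (sf_mor L g)) (theta F G))
      & forall (F G : sheaf K D) (O : D) (s : F O) (t : G O)
          (W : C) (h : O <=o u W) (a : L F W) (b : L G W),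
          adj_unit adj F O s = inverse_section h a ->
          adj_unit adj G O t = inverse_section h b ->
          sf_mor (inverse_image K u) (theta F G) O
            (adj_unit adj (sheaf_tensor F G) O (tensor_section s t)) =
          inverse_section h (tensor_section a b)].

Section Analytic.
Context (R : realType).

(* The partial sum over [0, N)^n of a series indexed by multi-indices. *)
Definition box_sum n (N : nat) (F : {ffun 'I_n -> nat} -> R) : R :=
  \sum_(a : {ffun 'I_n -> 'I_N}) F [ffun i => nat_of_ord (a i)].

Definition monomial n (a : {ffun 'I_n -> nat}) (h : 'rV[R]_n) : R :=
  \prod_(i < n) h 0 i ^+ a i.

(* [f] is the sum of an absolutely convergent power series on a polydisc
   centered at [x]. *)
Definition analytic_at n (f : 'rV[R]_n -> R) (x : 'rV[R]_n) : Prop :=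
  exists (c : {ffun 'I_n -> nat} -> R) (r : R), 0 < r /\
    forall h : 'rV[R]_n, (forall i, `|h 0 i| < r) ->
      (exists B : R, forall N, box_sum N (fun a => `|c a * monomial a h|) <= B) /\
      (fun N => box_sum N (fun a => c a * monomial a h)) @ \oo --> f (x + h).

Record chart (T : topologicalType) (n : nat) := Chart {
  chart_dom : set T;
  chart_map : T -> 'rV[R]_n }.

(* A homeomorphism from an open subset of [T] onto an open subset of R^n. *)
Definition is_chart (T : topologicalType) n (c : chart T n) : Prop :=
  [/\ open (chart_dom c),
      forall x, chart_dom c x -> {for x, continuous (chart_map c)},
      forall x y, chart_dom c x -> chart_dom c y ->
        chart_map c x = chart_map c y -> x = y &
      forall O, open O -> O `<=` chart_dom c -> open (chart_map c @` O)].

Definition compatible (T : topologicalType) n (c c' : chart T n) : Prop :=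
  forall x, chart_dom c x -> chart_dom c' x -> forall i : 'I_n,
    exists g : 'rV[R]_n -> R, analytic_at g (chart_map c x) /\
      \forall y \near x, chart_map c' y 0 i = g (chart_map c y).

Record analytic_manifold := AnalyticManifold {
  mfd_top :> topologicalType;
  mfd_hausdorff : hausdorff_space mfd_top;
  mfd_countable : @second_countable mfd_top;
  mfd_dim : nat;
  mfd_atlas : set (chart mfd_top mfd_dim);
  mfd_chart : forall c, mfd_atlas c -> is_chart c;
  mfd_cover : forall x, exists2 c, mfd_atlas c & chart_dom c x;
  mfd_compat : forall c c', mfd_atlas c -> mfd_atlas c' -> compatible c c' }.

Section Semianalytic.
Context (T : topologicalType) (n : nat) (A : set (chart T n)).

Definition analytic_on (U : set T) (f : T -> R) : Prop :=
  forall x c, U x -> A c -> chart_dom c x ->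
    exists g : 'rV[R]_n -> R, analytic_at g (chart_map c x) /\
      \forall y \near x, f y = g (chart_map c y).

(* Every point of [T] has an open neighbourhood [U] in which [Z] is a finite
   union of finite intersections of sets {f = 0} or {f > 0}, with [f] analytic
   on [U]. *)
Definition semianalytic (Z : set T) : Prop :=
  forall x : T, exists2 U : set T, open_nbhs x U &
    exists (p q : nat) (f : 'I_p -> 'I_q -> T -> R) (eqn : 'I_p -> 'I_q -> bool),
      (forall i j, analytic_on U (f i j)) /\
      forall y, U y ->
        (Z y <-> exists i, forall j,
          if eqn i j then f i j y = 0 else 0 < f i j y).

End Semianalytic.

Definition product_atlas (X : analytic_manifold) (k : nat) :
    set (chart (X * 'rV[R]_k)%type (mfd_dim X + k)) :=
  [set d | exists2 c, @mfd_atlas X c &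
    d = Chart (chart_dom c `*` setT) (fun z => row_mx (chart_map c z.1) z.2)].

(* Every point of [X] has a neighbourhood in which [Z] is the projection of a
   relatively compact semianalytic subset of some X * R^k. *)
Definition subanalytic (X : analytic_manifold) (Z : set X) : Prop :=
  forall x : X, exists2 U : set X, open_nbhs x U &
    exists (k : nat) (B : set (X * 'rV[R]_k)%type),
      [/\ semianalytic (@product_atlas X k) B, compact (closure B) &
          Z `&` U = fst @` B].

Section UsualSite.
Context (T : topologicalType).

Definition usual_open : Type := {U : set T | open U}.

Definition usual_le (U V : usual_open) : Prop := sval U `<=` sval V.

Definition usual_cov (U : usual_open) (C : set usual_open) : Prop :=
  (forall V, C V -> usual_le V U) /\
  forall x, sval U x -> exists2 V, C V & sval V x.

Let usual_cov_restr U C V : usual_cov U C -> usual_le V U ->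
  usual_cov V [set W | usual_le W V /\ exists2 W', C W' & usual_le W W'].
Proof.
move=> [_ UC] VU; split=> [W []//|x Vx].
have [W CW Wx] := UC x (VU x Vx).
exists (exist _ (sval W `&` sval V) (openI (svalP W) (svalP V))) => //=.
by split=> [y []//|]; exists W => // y [].
Qed.

Definition usual_site : site :=
  @Site usual_open usual_le (fun _ _ => id) (fun _ _ _ h h' x Ux => h' x (h x Ux))
    usual_cov (fun U C V h CV => h.1 V CV) usual_cov_restr.

End UsualSite.

Section SubanalyticSite.
Context (X S : analytic_manifold).

Definition op_sa (U : set X) : Prop := open U /\ subanalytic U.

Definition cov_sa (U : set X) (F : set (set X)) : Prop :=
  (forall A, F A -> op_sa A /\ A `<=` U) /\
  forall Q : set X, compact Q -> exists F0 : set (set X),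
    [/\ finite_set F0, F0 `<=` F &
        Q `&` \bigcup_(A in F0) A = Q `&` U].

Definition cov_open (V : set S) (G : set (set S)) : Prop :=
  (forall B, G B -> open B) /\ \bigcup_(B in G) B = V.

Definition op_product (W : set (X * S)%type) : Prop :=
  exists (n : nat) (U : 'I_n -> set X) (V : 'I_n -> set S),
    (forall i, op_sa (U i) /\ open (V i)) /\
    W = \bigcup_(i in setT) (U i `*` V i).

(* [C] covers U * V when it is refined by a product of coverings. *)
Definition cov_rectangle (U : set X) (V : set S) (C : set (set (X * S)%type)) :
    Prop :=
  exists (F : set (set X)) (G : set (set S)), [/\ cov_sa U F, cov_open V G &
    forall A B, F A -> G B -> exists2 W, C W & A `*` B `<=` W].

Definition sa_open : Type := {W : set (X * S)%type | op_product W}.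

Definition sa_le (W W' : sa_open) : Prop := sval W `<=` sval W'.

Definition sa_cov (W : sa_open) (C : set sa_open) : Prop :=
  (forall W', C W' -> sa_le W' W) /\
  forall (U : set X) (V : set S), op_sa U -> open V -> U `*` V `<=` sval W ->
    cov_rectangle U V [set sval W' `&` (U `*` V) | W' in C].

Lemma op_rectangle U V : op_sa U -> open V -> op_product (U `*` V).
Proof.
move=> sU oV; exists 1%N, (fun=> U), (fun=> V); split=> //.
by rewrite bigcup_const //; exists ord0.
Qed.

Let sa_cov_restr W C W1 : sa_cov W C -> sa_le W1 W ->
  sa_cov W1 [set W2 | sa_le W2 W1 /\ exists2 W', C W' & sa_le W2 W'].
Proof.
move=> [_ WC] W1W; split=> [W2 []//|U V sU oV UV].
have [F [G [UF VG FG]]] := WC U V sU oV (subset_trans UV W1W).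
exists F, G; split=> // A B FA GB.
have [sA AU] := UF.1 A FA; have oB := VG.1 B GB.
have [_ [W' CW' <-] ABW'] := FG A B FA GB.
have ABUV : A `*` B `<=` U `*` V by move=> z /ABW' [].
exists ((A `*` B) `&` (U `*` V)); last by move=> z ABz; split=> //; exact: ABUV.
exists (exist _ (A `*` B) (op_rectangle sA oB)) => //; split.
  by move=> z /ABUV /UV.
by exists W' => // z /ABW' [].
Qed.

Definition sa_site : site :=
  @Site sa_open sa_le (fun _ _ => id) (fun _ _ _ h h' x Ux => h' x (h x Ux))
    sa_cov (fun U C V h CV => h.1 V CV) sa_cov_restr.

Lemma op_product_open W : op_product W -> open W.
Proof.
move=> [n [U [V [UV ->]]]]; apply: bigcup_open => i _.
rewrite openE => -[x y] [/= Ux Vy]; have [[oU _] oV] := UV i.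
by exists (U i, V i) => //; split; exact: open_nbhs_nbhs.
Qed.

Definition rho_op (W : sa_site) : usual_site (X * S)%type :=
  exist _ (sval W) (op_product_open (svalP W)).

Let rho_mono (W W' : sa_site) : W <=o W' -> rho_op W <=o rho_op W'.
Proof. by []. Qed.

Let rho_cov (W : sa_site) C : site_cov W C -> site_cov (rho_op W) (rho_op @` C).
Proof.
move=> [CW cov]; split=> [_ [W' CW' <-]|]; first exact: CW.
move=> [x y] /= Wxy; have [n [U [V [UV WE]]]] := svalP W.
have : (\bigcup_(i in setT) (U i `*` V i)) (x, y) by rewrite -WE.
move=> [i _ [/= Ux Vy]]; have [sU oV] := UV i.
have UVW : U i `*` V i `<=` sval W by rewrite WE => z ?; exists i.
have [F [G [[_ UF] [_ GV] FG]]] := cov _ _ sU oV UVW.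
have [F0 [_ F0F]] := UF [set x] (@compact_set1 _ x).
move/seteqP => -[_ /(_ x) []]; first by split.
move=> _ [A F0A Ax]; move: Vy; rewrite -GV => -[B GB By].
have [_ [W' CW' <-] ABW'] := FG A B (F0F A F0A) GB.
exists (rho_op W'); first by exists W'.
by have [] := ABW' (x, y) (conj Ax By).
Qed.

Definition rho : site_morphism (usual_site (X * S)%type) sa_site :=
  SiteMorphism rho_mono rho_cov.

End SubanalyticSite.

End Analytic.

(* Main.v *)
Require Import Defs.
From mathcomp Require Import all_boot all_order all_algebra.
From mathcomp Require Import all_classical all_reals all_analysis.
From mathcomp Require Import complex freeg lra.

(* For W open in X_sa * S and O open in X * S, write W << O when there is a closed
   set Q of X with W contained in Q * S and Q * {s} contained in O for each s in
   the projection of W to S.  A natural family of maps F(O) -> G(W), W << O, is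
   the same thing as a morphism F -> rho^-1 G, because the sections of rho^-1 G
   over O are the compatible families in G(W), W << O; it is also the same thing
   as a morphism L F -> G, where L F is the sheaf associated with
   W |-> colim_(W << O) F(O).  So L is left adjoint to rho^-1.  Since the colimits
   are filtered and an open covering of O induces a covering of any W << O, L is
   exact and commutes with tensor products. *)

Set Implicit Arguments.
Unset Strict Implicit.
Unset Printing Implicit Defensive.

Import Order.TTheory GRing.Theory Num.Theory.
Import numFieldNormedType.Exports.

Local Open Scope classical_set_scope.
Local Open Scope ring_scope.

(** * Gluing in sheaves *)

(** [Q] is only closed so that every [W] is below some [O]: take for [Q] the whole of X and for [O]
    the whole of X * S. Compactness, which is what allows [Q] to be cut into finitely many boxes, is
    recovered on the members of a covering of [W]. The margin between [W] and [O] is asked in the X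
    direction alone, because X_sa has fewer coverings than X, while in the S direction all open
    coverings are available. The box structure also explains why compatible families are sections of
    rho^-1 G: a small box times an open set of S is open in both sites, so near each point of [O]
    one value of the family already defines a section of the inverse image. *)

Section LocallyTheory.
Context (C : site).
Implicit Types (P Q : C -> Prop) (U V : C).

Lemma locally_self P U : locally P U -> locally (fun V => V <=o U /\ P V) U.
Proof.
elim=> [{}U PU|{}U T UT _ IH]; first by apply: locally_here; split=> //; exact: site_le_refl.
apply: (locally_cov UT) => V TV; apply: locally_sub (IH V TV) => W [WV PW].
by split=> //; exact: site_le_trans WV (site_cov_le UT TV).
Qed.

Lemma locally_bind P Q U :
  locally P U -> (forall V, V <=o U -> P V -> locally Q V) -> locally Q U.
Proof.
move=> /locally_self lP PQ; apply: locally_idem.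
by apply: locally_sub lP => V [VU PV]; exact: PQ.
Qed.

End LocallyTheory.

Section SheafGluing.
Context (K : fieldType) (C : site) (G : sheaf K C).

(** The sheaf axiom speaks of the given covering families only; an induction on [locally] carries
    uniqueness over to the topology that they generate. *)
Lemma sheaf_separated : Defs.separated G.
Proof.
move=> U s.
suff zero V : locally (fun V => exists h : V <=o U, res G h s = 0) V ->
    forall h : V <=o U, res G h s = 0.
  by move=> /zero /(_ (site_le_refl U)); rewrite res_id.
elim=> [{}V [h E] h'|{}V T VT _ IH h]; first by rewrite (Prop_irrelevance h' h).
apply: (proj1 (sheafP G VT)) => W k TW.
by rewrite (res_comp _ _ (site_le_trans k h)) linear0; exact: IH.
Qed.

Lemma sheaf_eq U (x y : G U) :
  locally (fun V => forall h : V <=o U, res G h x = res G h y) U -> x = y.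
Proof.
move=> /locally_self lxy; apply/eqP; rewrite -subr_eq0; apply/eqP/sheaf_separated.
by apply: locally_sub lxy => V [h xy]; exists h; rewrite linearB xy subrr.
Qed.

(** [R] is a partial choice of sections, stable under restriction. Describing the pieces by a
    relation avoids naming a covering, and the conclusion governs every [V] below [U], not only the
    members of one covering. *)
Lemma glue (R : forall V, G V -> Prop) U :
  (forall V V' (h : V' <=o V) x, R V x -> R V' (res G h x)) ->
  (forall V x y, R V x -> R V y -> x = y) ->
  locally (fun V => exists x, R V x) U ->
  exists x : G U, forall V (h : V <=o U) y, R V y -> res G h x = y.
Proof.
move=> Rres Rfun.
have dR : down_closed (fun V => exists x, R V x).
  by move=> V V' h [x Rx]; exists (res G h x); exact: Rres.
elim=> [{}U [x Rx]|{}U T UT lT IH].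
  by exists x => V h y Ry; apply: Rfun Ry; exact: Rres.
pose good V (x : G V) := forall W (h : W <=o V) y, R W y -> res G h x = y.
(* The sheaf axiom wants a family over all opens; on the members of [T] the default 0 is never
   taken. *)
pose fam V : G V := if pselect (exists x, good V x) is left e then projT1 (cid e) else 0.
have famP V : T V -> good V (fam V).
  move=> TV; rewrite /fam; case: pselect => [e|]; first by case: (cid e).
  by case; exact: IH.
have [_] := sheafP G UT => /(_ fam) [].
  move=> V V' W h h' TV TV'; apply: sheaf_eq.
  apply: locally_sub (locally_le dR (lT V TV) h) => W' [y Ry] k.
  rewrite !(res_comp _ _ (site_le_trans k h)) !(res_comp _ _ (site_le_trans k h')).
  by rewrite (famP V TV _ _ y) // (famP V' TV' _ _ y).
move=> x xfam; exists x => V h y Ry; apply: sheaf_eq.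
apply: (locally_cov (site_cov_restr UT h)) => W [_ [V' TV' WV']].
apply: locally_here => k.
rewrite (res_comp _ _ (site_le_trans WV' (site_cov_le UT TV'))).
rewrite -(res_comp (site_cov_le UT TV') WV') xfam //.
by apply: famP => //; exact: Rres.
Qed.

(** Two values of [R] at [a] differ by a value at 0, so [R] only has to be single-valued there. *)
Lemma glue_linear (A : lmodType K) (R : forall V, A -> G V -> Prop) U :
  (forall V V' (h : V' <=o V) a x, R V a x -> R V' a (res G h x)) ->
  (forall V k a b x y, R V a x -> R V b y -> R V (k *: a + b) (k *: x + y)) ->
  (forall V x, R V 0 x -> x = 0) ->
  (forall a, locally (fun V => exists x, R V a x) U) ->
  exists f : {linear A -> G U},
    forall a V (h : V <=o U) y, R V a y -> res G h (f a) = y.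
Proof.
move=> Rres Rlin R0 Rloc.
have Rfun V a x y : R V a x -> R V a y -> x = y.
  move=> Rx Ry; apply/eqP; rewrite -subr_eq0; apply/eqP/R0.
  have := Rlin _ (-1) _ _ _ _ Ry Rx.
  by rewrite !scaleN1r addNr [- y + x]addrC.
have ex a := glue (fun V V' h => @Rres V V' h a) (fun V => @Rfun V a) (Rloc a).
pose f a := projT1 (cid (ex a)).
have fE a V (h : V <=o U) y : R V a y -> res G h (f a) = y.
  by rewrite /f; case: cid => /= x xE; exact: xE.
have dR a : down_closed (fun V => exists x, R V a x).
  by move=> V V' h [x Rx]; exists (res G h x); exact: Rres.
have fl : linear f.
  move=> k a b; apply: sheaf_eq.
  apply: locally_sub (locally_and (dR a) (dR b) (Rloc a) (Rloc b)).
  move=> V [[x Rx] [y Ry]] h; rewrite linearP (fE a _ _ _ Rx) (fE b _ _ _ Ry).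
  by apply: fE; exact: Rlin.
by exists (linear_of fl).
Qed.

End SheafGluing.

(* The properties of the relation [W << O] that only involve the two sites; the
   inclusion order of a site is another instance. *)
Record approximation (C D : site) := Approximation {
  way_below :> C -> D -> Prop;
  wb_mono : forall W W' O O',
    W' <=o W -> O <=o O' -> way_below W O -> way_below W' O';
  wb_cov : forall W O T, way_below W O -> site_cov O T ->
    locally (fun W' => exists2 O', T O' & way_below W' O') W;
  wb_dir : forall W O O', way_below W O -> way_below W O' ->
    exists O'', [/\ O'' <=o O, O'' <=o O' & way_below W O''] }.

Lemma wb_le (C D : site) (A : approximation C D) W W' O :
  W' <=o W -> A W O -> A W' O.
Proof. by move=> h; apply: wb_mono h (site_le_refl O). Qed.

(** Iterating [wb_cov] along the generation of [locally P O] turns what holds locally on [O] into a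
    covering of [W]. *)
Lemma wb_locally (C D : site) (A : approximation C D) W O (P : D -> Prop) :
  A W O -> locally P O ->
  locally (fun W' => W' <=o W /\ exists O', [/\ O' <=o O, P O' & A W' O']) W.
Proof.
move=> WO /locally_self lP; apply: locally_self.
suff H O1 : locally (fun V => V <=o O /\ P V) O1 -> forall W, A W O1 ->
    locally (fun W' => exists O', [/\ O' <=o O, P O' & A W' O']) W by exact: H WO.
elim=> [{}O1 [ O1O PO1] W1 h|{}O1 T OT _ IH W1 h].
  by apply: locally_here; exists O1.
apply: locally_bind (wb_cov h OT) _ => V _ [ O' TO' VO'].
exact: IH TO' _ VO'.
Qed.

(** For this instance a [cross] amounts to a morphism of presheaves, so universal properties proved
    for families indexed by [W << O] can be reused on a single site. *)
Program Definition le_approximation (C : site) : approximation C C :=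
  @Approximation C C (@site_le C) _ _ _.
Next Obligation.
by move=> C W W' O O' h h' k; apply: site_le_trans h' ; apply: site_le_trans k.
Qed.
Next Obligation.
move=> C W O T WO OT; apply: (locally_cov (site_cov_restr OT WO)) => V [_ [V' TV' VV']].
by apply: locally_here; exists V'.
Qed.
Next Obligation.
by move=> C W O O' h h'; exists W; split=> //; exact: site_le_refl.
Qed.

(** * Natural families indexed by W << O *)

Section CrossMorphism.
Context (K : fieldType) (C D : site) (A : approximation C D).

Record cross (F : presheaf K D) (G : presheaf K C) := Cross {
  cross_app : forall W O, A W O -> {linear F O -> G W};
  cross_nat : forall W W' O O' (k : A W O) (k' : A W' O') (h : W' <=o W)
    (h' : O <=o O') (s : F O'),
    res G h (cross_app k (res F h' s)) = cross_app k' s }.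

(** Together with [locally_faithful] this says that [eta] becomes an isomorphism after
    sheafification. *)
Definition locally_onto (E : site) (P Q : presheaf K E) (eta : pmor P Q) :=
  forall U (y : Q U),
    locally (fun V => exists (h : V <=o U) (x : P V), eta V x = res Q h y) U.

Definition locally_faithful (E : site) (P Q : presheaf K E) (eta : pmor P Q) :=
  forall U (x : P U), eta U x = 0 -> locally_zero x.

Lemma cross_natl (F : presheaf K D) (G : presheaf K C) (phi : cross F G)
    W W' O (k : A W O) (k' : A W' O) (h : W' <=o W) (s : F O) :
  res G h (cross_app phi k s) = cross_app phi k' s.
Proof.
by rewrite -(cross_nat phi k k' h (site_le_refl O)) res_id.
Qed.

Lemma cross_natr (F : presheaf K D) (G : presheaf K C) (phi : cross F G)
    W O O' (k : A W O) (k' : A W O') (h' : O <=o O') (s : F O') :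
  cross_app phi k (res F h' s) = cross_app phi k' s.
Proof.
by rewrite -(cross_nat phi k k' (site_le_refl W) h') res_id.
Qed.

(** A section of [P'] lifts to [P] locally on [O], hence over some [O'] above each member of a
    covering of [W]. There [phi] prescribes the value, and the values glue because [G] is a sheaf on
    the side of [W]. *)
Lemma cross_extend (P P' : presheaf K D) (eta : pmor P P') (G : sheaf K C)
    (phi : cross P G) : locally_onto eta -> locally_faithful eta ->
  {psi : cross P' G | forall W O (k : A W O) s,
     cross_app psi k (eta O s) = cross_app phi k s}.
Proof.
move=> onto faith; apply: cid.
pose R O V (y : P' O) (z : G V) := exists O' (h : O' <=o O) (k : A V O') p,
  eta O' p = res P' h y /\ z = cross_app phi k p.
have ex W O (k : A W O) : exists f : {linear P' O -> G W},
    forall y V (h : V <=o W) z, R O V y z -> res G h (f y) = z.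
  apply: glue_linear => [V V' h y z|V c a b x y|V z|y].
  - move=> [ O' [l [k' [p [pE ->]]]]].
    have k2 : A V' O' := wb_le h k'.
    exists O', l, k2, p; split=> //.
    by rewrite (cross_natl phi k' k2).
  - move=> [ O1 [l1 [k1 [p1 [p1E ->]]]]] [ O2 [l2 [k2 [p2 [p2E ->]]]]].
    have [ O3 [h31 h32 k3]] := wb_dir k1 k2.
    exists O3, (site_le_trans h31 l1), k3, (c *: res P h31 p1 + res P h32 p2); split.
      rewrite !linearP -!pmor_nat p1E p2E !(res_comp _ _ (site_le_trans h31 l1)).
      by [].
    by rewrite linearP !(cross_natr phi k3 _).
  (* A lift of 0 is locally zero by faithfulness, and [wb_locally] transfers this vanishing to
     [V]. *)
  - move=> [ O' [l [k' [p [pE ->]]]]]; apply: sheaf_eq.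
    rewrite linear0 in pE.
    apply: locally_sub (wb_locally k' (faith _ _ pE)).
    move=> V' [_ [ O2 [h2 [h3 p0] k2]]] h.
    have k3 : A V' O' := wb_le h k'.
    by rewrite (cross_natl phi k' k3) -(cross_natr phi k2 k3 h3) p0 !linear0.
  - apply: locally_sub (wb_locally k (onto _ y)).
    move=> V [_ [ O' [_ [h [p pE]] k']]].
    by exists (cross_app phi k' p), O', h, k', p.
pose f W O k := projT1 (cid (ex W O k)).
have fE W O k : forall y V (h : V <=o W) z, R O V y z -> res G h (f W O k y) = z.
  by rewrite /f; case: cid.
unshelve eexists (@Cross _ _ f _); last first.
  move=> W O k s /=; rewrite -[LHS](res_id (site_le_refl W)); apply: (fE).
  by exists O, (site_le_refl O), k, s; rewrite res_id.
move=> W W' O O' k k' h h' s; apply: sheaf_eq.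
apply: locally_sub (wb_locally (wb_mono h (site_le_refl O) k) (onto _ (res P' h' s))).
move=> V [VW [ O2 [_ [l [p pE]] k2]]] h2.
rewrite (res_comp _ _ (site_le_trans h2 h)).
rewrite (fE _ _ k _ _ _ (cross_app phi k2 p)); last by exists O2, l, k2, p.
symmetry; apply: fE; exists O2, (site_le_trans l h'), k2, p.
by rewrite pE (res_comp _ _ (site_le_trans l h')).
Qed.

Lemma cross_ext (P P' : presheaf K D) (eta : pmor P P') (G : sheaf K C)
    (phi psi : cross P' G) : locally_onto eta ->
  (forall W O (k : A W O) s,
    cross_app phi k (eta O s) = cross_app psi k (eta O s)) ->
  forall W O (k : A W O) s, cross_app phi k s = cross_app psi k s.
Proof.
move=> onto E W O k s; apply: sheaf_eq.
apply: locally_sub (wb_locally k (onto _ s)).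
move=> V [VW [ O' [_ [l [p pE]] k']]] h.
have k2 : A V O := wb_le h k.
by rewrite !(cross_natl _ k k2) -!(cross_natr _ k' k2 l) -pE E.
Qed.

End CrossMorphism.

(** * The unit of sheafification is locally bijective *)

Section SheafificationTheory.
Context (K : fieldType) (C : site).

Lemma plus_unit_onto (P : presheaf K C) : locally_onto (plus_unit P).
Proof.
move=> U y; have [s Ms ->] := subquotP y.
have := locally_self (Ms : locally (coherent_at s) U).
apply: locally_sub => V [h cs]; exists h, (s V).
apply/esym; apply: etrans (plus_resE h Ms) _.
apply/sqpi_eq; [exact: (matching_le h Ms)| exact: restrictions_mem|].
apply: locally_here => W WV; rewrite dprodB (restrictionsE _ WV).
by rewrite cs subrr.
Qed.

Lemma plus_unit_faithful (P : presheaf K C) : locally_faithful (plus_unit P).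
Proof.
move=> U x /(iffLR (sqpi_eq0 (vanishing P U) (restrictions_mem x))).
move/locally_self.
apply: locally_sub => V [h z]; exists h.
by rewrite -(restrictionsE x h); apply: z; exact: site_le_refl.
Qed.

Lemma comp_onto (P Q S : presheaf K C) (g : pmor Q S) (f : pmor P Q) :
  locally_onto g -> locally_onto f -> locally_onto (pmor_comp g f).
Proof.
move=> og of' U y; apply: locally_bind (og _ y) _ => V _ [h [x xE]].
apply: locally_sub (of' _ x) => W [h' [z zE]].
exists (site_le_trans h' h), z => /=.
by rewrite zE -pmor_nat xE (res_comp _ _ (site_le_trans h' h)).
Qed.

Lemma comp_faithful (P Q S : presheaf K C) (g : pmor Q S) (f : pmor P Q) :
  locally_faithful g -> locally_faithful f -> locally_faithful (pmor_comp g f).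
Proof.
move=> fg ff U x /fg lz; apply: locally_bind lz _ => V _ [h].
rewrite pmor_nat => /ff; apply: locally_sub => W [h' E].
exists (site_le_trans h' h).
by rewrite -E (res_comp _ _ (site_le_trans h' h)).
Qed.

Lemma sheafify_unit_onto (P : presheaf K C) : locally_onto (sheafify_unit P).
Proof. apply: comp_onto; exact: plus_unit_onto. Qed.

Lemma sheafify_unit_faithful (P : presheaf K C) :
  locally_faithful (sheafify_unit P).
Proof. apply: comp_faithful; exact: plus_unit_faithful. Qed.

Lemma plus_map_unit (P Q : presheaf K C) (f : pmor P Q) U (s : P U) :
  plus_map f U (plus_unit P U s) = plus_unit Q U (f U s).
Proof.
apply: etrans (plus_map_appE f (restrictions_mem s)) _.
congr sqpi; apply: functional_extensionality_dep => V /=.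
rewrite /restrictions; case: pselect => [h|_]; last by rewrite linear0.
by rewrite pmor_nat.
Qed.

Lemma sheafify_map_unit (P Q : presheaf K C) (f : pmor P Q) U (s : P U) :
  sheafify_map f U (sheafify_unit P U s) = sheafify_unit Q U (f U s).
Proof.
apply: etrans (plus_map_unit (plus_map f) _) _.
by congr (plus_unit _ _ _); exact: plus_map_unit.
Qed.

End SheafificationTheory.

(** * Linear maps out of presented vector spaces *)

Section PresentedLift.
Context (K : fieldType) (X : choiceType) (E : {freeg X / K} -> Prop).
Context (V : lmodType K) (f : X -> V).

Lemma fglift_linear : linear (fglift f : {freeg X / K} -> V).
Proof.
have lB x y : fglift f (x - y) = fglift f x - fglift f y :> V.
  exact: (@lift_is_additive K X _ f).
have lN z : fglift f (- z) = - fglift f z :> V.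
  by rewrite -sub0r lB -(subrr 0) lB subrr sub0r.
have lD : {morph (fglift f : {freeg X / K} -> V) : x y / x + y}.
  by move=> x y; rewrite -[y in LHS]opprK lB lN opprK.
have l0 : fglift f 0 = 0 :> V.
  by apply: (@addrI _ (fglift f 0)); rewrite -lD !addr0.
have lZ c x : fglift f (c *: << x >>) = c *: f x :> V.
  have -> : c *: << x >> = << c *g x >> :> {freeg X / K}.
    by apply/eqP/freeg_eqP => y; rewrite coeffZ !coeffU mul1r.
  by rewrite liftU.
move=> k u v; rewrite lD; congr (_ + _).
elim/freeg_ind: u => [|l x Z IH]; first by rewrite !scaler0 l0 scaler0.
by rewrite scalerDr !lD scalerDr IH scalerA !lZ scalerA.
Qed.

Definition freeg_lift : {linear {freeg X / K} -> V} := linear_of fglift_linear.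

Lemma freeg_liftE x : freeg_lift << x >> = f x.
Proof. by rewrite /= liftU scale1r. Qed.

Lemma presented_lift : (forall e, E e -> freeg_lift e = 0) ->
  {g : {linear presented E -> V} | forall x, g (pgen E x) = f x}.
Proof.
move=> fE.
have kE v : Defs.span E v -> freeg_lift v = 0.
  have N0 : freeg_lift 0 = 0 by rewrite linear0.
  have NP k u w : freeg_lift u = 0 -> freeg_lift w = 0 ->
      freeg_lift (k *: u + w) = 0.
    by move=> u0 w0; rewrite linearP u0 w0 scaler0 addr0.
  by move=> /(_ (Subspace (in_subspace := fun v => freeg_lift v = 0) N0 NP)); apply.
pose g (q : presented E) : V := freeg_lift (sqrepr q).
have gE v : g (pclass E v) = freeg_lift v.
  apply/eqP; rewrite -subr_eq0 -linearB; apply/eqP/kE.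
  exact: sqreprN.
have gl : linear g.
  move=> k p q; have [u _ ->] := subquotP p; have [v _ ->] := subquotP q.
  by rewrite -sqpiZ // -sqpiD // !gE linearP.
by exists (linear_of gl) => x; rewrite [LHS]gE freeg_liftE.
Qed.

End PresentedLift.

Section PresentedInduction.
Context (K : fieldType) (X : choiceType) (E : {freeg X / K} -> Prop).

Lemma presented_ind (P : presented E -> Prop) : P 0 ->
  (forall k x q, P q -> P (k *: pgen E x + q)) -> forall q, P q.
Proof.
move=> P0 PS q; have [v _ ->] := subquotP q.
elim/freeg_ind: v => [|k x Z IH]; first by rewrite sqpi0.
by rewrite sqpiD // sqpiZ //; exact: PS.
Qed.

End PresentedInduction.

Section CrossComposition.
Context (K : fieldType) (C D : site) (A : approximation C D).

Program Definition cross_post (F : presheaf K D) (G G' : presheaf K C)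
    (f : pmor G G') (phi : cross A F G) : cross A F G' :=
  @Cross K C D A F G' (fun W O k => linear_of (linear_comp (f W) (cross_app phi k))) _.
Next Obligation.
by move=> F G G' f phi W W' O O' k k' h h' s; rewrite /= pmor_nat cross_nat.
Qed.

Program Definition cross_pre (F' F : presheaf K D) (G : presheaf K C)
    (phi : cross A F G) (f : pmor F' F) : cross A F' G :=
  @Cross K C D A F' G (fun W O k => linear_of (linear_comp (cross_app phi k) (f O))) _.
Next Obligation.
by move=> F' F G phi f W W' O O' k k' h h' s; rewrite /= -pmor_nat cross_nat.
Qed.

Lemma cross_postE (F : presheaf K D) (G G' : presheaf K C) (f : pmor G G')
    (phi : cross A F G) W O (k : A W O) s :
  cross_app (cross_post f phi) k s = f W (cross_app phi k s).
Proof. by []. Qed.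

Lemma cross_preE (F' F : presheaf K D) (G : presheaf K C) (phi : cross A F G)
    (f : pmor F' F) W O (k : A W O) s :
  cross_app (cross_pre phi f) k s = cross_app phi k (f O s).
Proof. by []. Qed.

End CrossComposition.

(** * The presheaf of germs and its associated sheaf *)

Section Shriek.
Context (K : fieldType) (C D : site) (A : approximation C D).
Context (wb_top : forall W, exists O, A W O).

Section Germs.
Context (F : presheaf K D).

Definition coherent_germs (W : C) : Defs.subspace (dprod F).
Proof.
refine (@Subspace K (dprod F) (fun s => exists2 O, A W O & coherent_at s O) _ _).
  (* The colimit contains 0 only if its index category is non-empty, which is [wb_top]. *)
  by have [ O WO] := wb_top W; exists O => // V h; rewrite linear0.
move=> k s t [ O1 k1 c1] [ O2 k2 c2]; have [ O3 [h1 h2 k3]] := wb_dir k1 k2.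
exists O3 => // V h; rewrite !dprodP linearP.
by rewrite -(coherent_at_down h1 c1) -(coherent_at_down h2 c2).
Defined.

Definition vanishing_germs (W : C) : Defs.subspace (dprod F).
Proof.
refine (@Subspace K (dprod F) (fun s => exists2 O, A W O & zero_below s O) _ _).
  by have [ O WO] := wb_top W; exists O.
move=> k s t [ O1 k1 c1] [ O2 k2 c2]; have [ O3 [h1 h2 k3]] := wb_dir k1 k2.
exists O3 => // V h; rewrite !dprodP.
by rewrite (zero_below_down h1 c1) // (zero_below_down h2 c2) // scaler0 addr0.
Defined.

Definition germ_sec (W : C) : lmodType K :=
  subquot (coherent_germs W) (vanishing_germs W).

Lemma coherent_germs_le W W' (h : W' <=o W) s :
  coherent_germs W s -> coherent_germs W' (idlin _ s).
Proof. by move=> [ O k c]; exists O => //; exact: wb_le k. Qed.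

Lemma vanishing_germs_le W W' (h : W' <=o W) s :
  vanishing_germs W s -> vanishing_germs W' (idlin _ s).
Proof. by move=> [ O k c]; exists O => //; exact: wb_le k. Qed.

Definition germ_res W W' (h : W' <=o W) : {linear germ_sec W -> germ_sec W'} :=
  sqmap (coherent_germs_le h) (vanishing_germs_le h).

Lemma germ_resE W W' (h : W' <=o W) s : coherent_germs W s ->
  germ_res h (sqpi _ _ s) = sqpi _ _ s.
Proof. by move=> cs; rewrite /germ_res sqmapE. Qed.

Lemma germ_res_id W (h : W <=o W) s : germ_res h s = s.
Proof. by have [v Mv ->] := subquotP s; rewrite germ_resE. Qed.

Lemma germ_res_comp U V W (h : V <=o U) (h' : W <=o V) (h'' : W <=o U) s :
  germ_res h' (germ_res h s) = germ_res h'' s.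
Proof.
have [v Mv ->] := subquotP s; rewrite !germ_resE //.
exact: (coherent_germs_le h Mv).
Qed.

(* The presheaf W |-> colim_(W << O) F O, a germ being represented, as in [plus],
   by a family of sections over all opens. *)
Definition germs : presheaf K C := Presheaf germ_res_id germ_res_comp.

Lemma restrictions_germ W O (k : A W O) (s : F O) :
  coherent_germs W (restrictions s).
Proof.
exists O => // V h; rewrite (restrictionsE _ h) (restrictionsE _ (site_le_refl O)).
by rewrite (res_comp _ _ h).
Qed.

Lemma germ_linear W O (k : A W O) :
  linear (fun s : F O => sqpi _ _ (restrictions s) : germs W).
Proof.
move=> c s t; rewrite restrictions_linear.
have mem := restrictions_germ k.
by rewrite sqpiD ?sqpiZ //; apply: subspaceZ; exact: mem.
Qed.

Definition germ W O (k : A W O) : {linear F O -> germs W} :=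
  linear_of (germ_linear k).

Lemma germ_nat W W' O O' (k : A W O) (k' : A W' O') (h : W' <=o W)
    (h' : O <=o O') (s : F O') :
  res germs h (germ k (res F h' s)) = germ k' s.
Proof.
apply: etrans (germ_resE h (restrictions_germ k _)) _.
apply/sqpi_eq; [exact: (restrictions_germ (wb_le h k))|
                exact: (restrictions_germ k')|].
exists O => [|V VO]; first exact: wb_le k.
rewrite dprodB (restrictionsE _ VO) (restrictionsE _ (site_le_trans VO h')).
by rewrite (res_comp _ _ (site_le_trans VO h')) subrr.
Qed.

Lemma germ_natl W W' O (k : A W O) (k' : A W' O) (h : W' <=o W) (s : F O) :
  res germs h (germ k s) = germ k' s.
Proof. by rewrite -(germ_nat k k' h (site_le_refl O)) res_id. Qed.

Lemma germP W (p : germs W) : exists O (k : A W O) s, p = germ k s.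
Proof.
have [s [ O k c] ->] := subquotP p; exists O, k, (s O).
apply/sqpi_eq; [by exists O|exact: (restrictions_germ k)|].
by exists O => // V h; rewrite dprodB (restrictionsE _ h) c subrr.
Qed.

Lemma germ_eq0 W O (k : A W O) (s : F O) : germ k s = 0 ->
  exists O' (h : O' <=o O), A W O' /\ res F h s = 0.
Proof.
move=> /(iffLR (sqpi_eq0 (vanishing_germs W) (restrictions_germ k s))).
move=> [ O1 k1 z]; have [ O2 [h h1 k2]] := wb_dir k k1.
by exists O2, h; split=> //; rewrite -(restrictionsE s h) z.
Qed.

Definition shriek_sheaf : sheaf K C := sheafify germs.

(** The universal natural family out of [F]. What follows uses this sheaf only through [ell],
    [ell_onto] and [ell_faithful], which are taken as hypotheses there so that germs need not be
    unfolded again. *)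
Program Definition ell : cross A F shriek_sheaf :=
  @Cross K C D A F shriek_sheaf
    (fun W O k => linear_of (linear_comp (sheafify_unit germs W) (germ k))) _.
Next Obligation.
move=> W W' O O' k k' h h' s.
by apply: etrans (pmor_nat _ _ _) _; congr (sheafify_unit _ _ _); exact: germ_nat.
Qed.

Lemma ell_onto W (x : shriek_sheaf W) :
  locally (fun V => exists (h : V <=o W) O (k : A V O) s,
    cross_app ell k s = res shriek_sheaf h x) W.
Proof.
apply: locally_sub (sheafify_unit_onto x) => V [h [p pE]].
have [ O [k [s sE]]] := germP p; exists h, O, k, s.
by rewrite sE in pE; exact: pE.
Qed.

Lemma ell_faithful W O (k : A W O) (s : F O) : cross_app ell k s = 0 ->
  locally (fun V => V <=o W /\
    exists O' (h : O' <=o O), A V O' /\ res F h s = 0) W.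
Proof.
move=> /sheafify_unit_faithful; apply: locally_sub => V [h].
rewrite (germ_natl k (wb_le h k)) => /germ_eq0.
by split.
Qed.

End Germs.

End Shriek.

(** * The functor on morphisms and its exactness *)

Section Corepresentation.
Context (K : fieldType) (C D : site) (A : approximation C D).
Context (L : presheaf K D -> sheaf K C) (ell : forall F, cross A F (L F)).
Context (ell_onto : forall (F : presheaf K D) W (x : L F W),
  locally (fun V => exists (h : V <=o W) O (k : A V O) s,
    cross_app (ell F) k s = res (L F) h x) W).
Context (ell_faithful : forall (F : presheaf K D) W O (k : A W O) (s : F O),
  cross_app (ell F) k s = 0 ->
  locally (fun V => V <=o W /\
    exists O' (h : O' <=o O), A V O' /\ res F h s = 0) W).

Lemma ell_ext (F : presheaf K D) (G : sheaf K C) (f g : pmor (L F) G) :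
  (forall W O (k : A W O) s, f W (cross_app (ell F) k s) = g W (cross_app (ell F) k s)) ->
  pmor_eq f g.
Proof.
move=> E W x; apply: sheaf_eq; apply: locally_sub (ell_onto x).
move=> V [h [ O [k [s sE]]]] h'.
by rewrite (Prop_irrelevance h' h) !pmor_nat -sE E.
Qed.

(** Directedness puts the representatives of two sections over one open, where they can be
    tensored. *)
Lemma ell_onto2 (F G : presheaf K D) W (x : L F W) (y : L G W) :
  locally (fun V => exists (h : V <=o W) O (k : A V O) s t,
    cross_app (ell F) k s = res (L F) h x /\
    cross_app (ell G) k t = res (L G) h y) W.
Proof.
apply: locally_bind (ell_onto x) _ => V _ [h [ O1 [k1 [s sE]]]].
apply: locally_sub (ell_onto (res _ h y)) => V' [h' [ O2 [k2 [t tE]]]].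
have [ O3 [l1 l2 k3]] := wb_dir (wb_le h' k1) k2.
exists (site_le_trans h' h), O3, k3, (res F l1 s), (res G l2 t).
rewrite (cross_natr _ k3 k2) tE (cross_natr _ k3 (wb_le h' k1)).
rewrite -(cross_natl _ k1 _ h') sE.
by split; exact: res_comp.
Qed.

(** Locally a section of [L F] is some [ell k s], and its image has to be [phi k s]; by
    [ell_faithful] the choice of [s] does not matter. Uniqueness is [ell_ext], so [L F] corepresents
    the natural families out of [F]. *)
Lemma shriek_lift (F : presheaf K D) (G : sheaf K C) (phi : cross A F G) :
  {g : pmor (L F) G |
    forall W O (k : A W O) s, g W (cross_app (ell F) k s) = cross_app phi k s}.
Proof.
apply: cid.
pose R W V (x : L F W) (z : G V) := exists (h : V <=o W) O (k : A V O) s,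
  cross_app (ell F) k s = res (L F) h x /\ z = cross_app phi k s.
have ex W : exists f : {linear L F W -> G W},
    forall x V (h : V <=o W) z, R W V x z -> res G h (f x) = z.
  apply: glue_linear => [V V' h x z|V c a b x y|V z|x].
  - move=> [l [ O [k [s [sE ->]]]]].
    exists (site_le_trans h l), O, (wb_le h k), s; split.
      by rewrite -(cross_natl _ k _ h) sE (res_comp _ _ (site_le_trans h l)).
    by rewrite -(cross_natl _ k _ h).
  - move=> [l [ O1 [k1 [s1 [s1E ->]]]]] [l' [ O2 [k2 [s2 [s2E ->]]]]].
    have [ O3 [h31 h32 k3]] := wb_dir k1 k2.
    exists l, O3, k3, (c *: res F h31 s1 + res F h32 s2); split.
      rewrite !linearP !(cross_natr _ k3 _) s1E s2E.
      by rewrite (Prop_irrelevance l' l).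
    by rewrite linearP !(cross_natr phi k3 _).
  - move=> [l [ O [k [s [+ ->]]]]]; rewrite linear0 => /ell_faithful lz.
    apply: sheaf_eq; apply: locally_sub lz => V' [_ [ O' [h [k' s0]]]] h'.
    rewrite (cross_natl _ k (wb_le h' k)) -(cross_natr _ k' _ h) s0.
    by rewrite !linear0.
  - apply: locally_sub (ell_onto x) => V [h [ O [k [s sE]]]].
    by exists (cross_app phi k s), h, O, k, s.
pose f W := projT1 (cid (ex W)).
have fE W : forall x V (h : V <=o W) z, R W V x z -> res G h (f W x) = z.
  by rewrite /f; case: cid.
have fn W V (h : V <=o W) x : res G h (f W x) = f V (res (L F) h x).
  apply: sheaf_eq; apply: locally_sub (ell_onto (res (L F) h x)).
  move=> V' [l [ O [k [s sE]]]] h'.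
  rewrite (res_comp _ _ (site_le_trans h' h)).
  rewrite (fE W _ _ _ (cross_app phi k s)).
    by apply/esym/fE; exists l, O, k, s.
  exists (site_le_trans h' h), O, k, s; split=> //.
  by rewrite sE !(res_comp _ _ (site_le_trans h' h)).
exists (Pmor fn) => W O k s /=; rewrite -[LHS](res_id (site_le_refl W)).
by apply: fE; exists (site_le_refl W), O, k, s; rewrite res_id.
Qed.

Definition shriek_map (F G : presheaf K D) (f : pmor F G) : pmor (L F) (L G) :=
  sval (shriek_lift (cross_pre (ell G) f)).

Lemma shriek_map_ell (F G : presheaf K D) (f : pmor F G) W O (k : A W O) s :
  shriek_map f W (cross_app (ell F) k s) = cross_app (ell G) k (f O s).
Proof. exact: (svalP (shriek_lift (cross_pre (ell G) f))). Qed.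

Program Definition shriek : sheaf_functor K D C :=
  @SheafFunctor K D C (fun F => L F) (fun F G f => shriek_map f) _ _ _.
Next Obligation.
by move=> F G f g fg; apply: ell_ext => W O k s; rewrite !shriek_map_ell fg.
Qed.
Next Obligation.
by move=> F; apply: ell_ext => W O k s; rewrite shriek_map_ell.
Qed.
Next Obligation.
by move=> F G H g f; apply: ell_ext => W O k s; rewrite /= !shriek_map_ell.
Qed.

(** The colimits are filtered: if the image of a germ vanishes, it does so over a smaller [O'], and
    there [f] is injective on sections. *)
Lemma shriek_mono (F G : sheaf K D) (f : pmor F G) :
  sheaf_mono f -> sheaf_mono (sf_mor shriek f).
Proof.
move=> fm W x x0; apply: sheaf_eq; apply: locally_bind (ell_onto x) _.
move=> V _ [h [ O [k [s sE]]]].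
have : shriek_map f V (cross_app (ell F) k s) = 0.
  by rewrite sE -pmor_nat [shriek_map f W x]x0 linear0.
rewrite shriek_map_ell => /ell_faithful; apply: locally_sub.
move=> V' [l [ O' [h' [k' E]]]] m; rewrite linear0.
have s0 : res F h' s = 0 by apply: fm; rewrite -pmor_nat.
rewrite -(res_comp h l) -sE (cross_natl _ k (wb_le l k)).
by rewrite -(cross_natr _ k' _ h') s0 linear0.
Qed.

(** Exactness rests on [wb_cov] here: the covering of [O] on which [t] lifts through [f] induces a
    covering of [V]. *)
Lemma in_image_shriek (F G : sheaf K D) (f : pmor F G) W (y : shriek G W) :
  locally (fun V => exists (h : V <=o W) O (k : A V O) t,
    cross_app (ell G) k t = res (shriek G) h y /\ in_image f t) W ->
  in_image (sf_mor shriek f) y.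
Proof.
move=> H; apply: locally_bind H _ => V _ [h [ O [k [t [tE im]]]]].
apply: locally_sub (wb_locally k im) => V' [l [ O' [_ [h' [s sE]] k']]].
exists (site_le_trans l h), (cross_app (ell F) k' s).
apply: etrans (shriek_map_ell _ _ _) _.
rewrite sE (cross_natr _ k' (wb_le l k)) -(cross_natl _ k _ l) tE.
by rewrite (res_comp _ _ (site_le_trans l h)).
Qed.

Lemma shriek_exact : exact_functor shriek.
Proof.
move=> F G H f g [fm ge fg]; split.
- exact: shriek_mono.
- move=> W y; apply: in_image_shriek; apply: locally_sub (ell_onto y).
  by move=> V [h [ O [k [t tE]]]]; exists h, O, k, t; split=> //; exact: ge.
- move=> W y; split=> [y0|].
    apply: in_image_shriek; apply: locally_bind (ell_onto y) _.
    move=> V _ [h [ O [k [t tE]]]].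
    have : shriek_map g V (cross_app (ell G) k t) = 0.
      by rewrite tE -pmor_nat [shriek_map g W y]y0 linear0.
    rewrite shriek_map_ell => /ell_faithful; apply: locally_sub.
    move=> V' [l [ O' [h' [k' E]]]].
    exists (site_le_trans l h), O', k', (res G h' t); split.
      rewrite (cross_natr _ k' (wb_le l k)) -(cross_natl _ k _ l) tE.
      by rewrite (res_comp _ _ (site_le_trans l h)).
    by apply/fg; rewrite -pmor_nat.
  move=> im; apply: sheaf_eq; apply: locally_bind im _ => V _ [h [x xE]].
  apply: locally_sub (ell_onto x) => V' [h' [ O [k [s sE]]]] m.
  rewrite linear0 pmor_nat -(res_comp h h') -xE pmor_nat -sE.
  apply: etrans (congr1 _ (shriek_map_ell _ _ _)) _.
  apply: etrans (shriek_map_ell _ _ _) _.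
  have -> : g O (f O s) = 0; last by rewrite linear0.
  apply/fg/locally_here; exists (site_le_refl O), s.
  by rewrite res_id.
Qed.

End Corepresentation.

(** Serves to pass from the presheaf inverse image to its sheafification: values that jointly detect
    local vanishing before it detect vanishing after it. *)
Lemma cross_joint_kernel (K : fieldType) (C D : site) (A : approximation C D)
    (P : presheaf K D) (S : sheaf K D) (eta : pmor P S) (G : presheaf K C)
    (phi : cross A P G) (psi : cross A S G) : locally_onto eta ->
  (forall W O (k : A W O) p, cross_app psi k (eta O p) = cross_app phi k p) ->
  (forall O p, (forall W (k : A W O), cross_app phi k p = 0) -> locally_zero p) ->
  forall O y, (forall W (k : A W O), cross_app psi k y = 0) -> y = 0.
Proof.
move=> onto psiE ker O y y0; apply: sheaf_eq.
apply: locally_bind (onto _ y) _ => O1 _ [h [p pE]].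
have /ker : forall W (k : A W O1), cross_app phi k p = 0.
  move=> W k; rewrite -psiE pE.
  by rewrite (cross_natr _ k (wb_mono (site_le_refl W) h k)).
apply: locally_sub => O2 [l p0] m.
by rewrite linear0 -(res_comp h l) -pE pmor_nat p0 linear0.
Qed.

(** * Sections of the inverse image as families of values *)

Section InverseImageEvaluation.
Context (K : fieldType) (C D : site) (A : approximation C D).
Context (u : site_morphism D C).
Context (wb_le_op : forall W O W', A W O -> O <=o u W' -> W <=o W').
Context (wb_nbhd : forall O, locally (fun O' => exists2 W, A W O & O' <=o u W) O).

Lemma nbhd_res_pgen (G : presheaf K C) O O' (h : O' <=o O) W (l : O <=o u W) (t : G W) :
  res (presheaf_inverse_image u G) h (pgen _ (NbhdSection l t)) =
  pgen _ (NbhdSection (site_le_trans h l) t).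
Proof. exact: pmapE. Qed.

Section Evaluation.
Context (G : presheaf K C).

(** If [W] is below [O] and [O] lies in [u W'], then [W] lies in [W'], so a section over [W']
    restricts to [W]. The restriction respects the relations of the colimit. *)
Lemma nbhd_eval_subproof W O (k : A W O)
  (f := fun x : nbhd_section u G O => res G (wb_le_op k (ns_le x)) (ns_sec x)) e :
  nbhd_rel e -> freeg_lift f e = 0.
Proof.
case=> [W' h c s t|W' W'' h h' m s].
  by rewrite linearB linearP !freeg_liftE /f /= linearP subrr.
rewrite linearB !freeg_liftE /f /= (res_comp _ _ (wb_le_op k h)).
by rewrite subrr.
Qed.

Definition nbhd_eval_app W O (k : A W O) :
    {linear presheaf_inverse_image u G O -> G W} :=
  sval (presented_lift (nbhd_eval_subproof k)).

Lemma nbhd_eval_appE W O (k : A W O) W' (h : O <=o u W') (t : G W') :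
  nbhd_eval_app k (pgen _ (NbhdSection h t)) = res G (wb_le_op k h) t.
Proof. exact: (svalP (presented_lift (nbhd_eval_subproof k))). Qed.

Lemma nbhd_eval_nat W W' O O' (k : A W O) (k' : A W' O') (h : W' <=o W)
    (h' : O <=o O') p :
  res G h (nbhd_eval_app k (res (presheaf_inverse_image u G) h' p)) =
  nbhd_eval_app k' p.
Proof.
elim/presented_ind: p => [|c [W1 l t] p IH]; first by rewrite !linear0.
rewrite !linearP IH (nbhd_res_pgen h' l t) !nbhd_eval_appE.
by rewrite (res_comp _ _ (wb_le_op k' l)).
Qed.

Definition nbhd_eval : cross A (presheaf_inverse_image u G) G :=
  Cross nbhd_eval_nat.

(** Since [O'] lies in [u W], the open [W] is itself an index of the colimit over [O'], and
    [nbhd_rel_res] moves every generator to it. A section is thus locally recovered from a single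
    value, which makes the evaluations jointly injective. *)
Lemma nbhd_evalK W O (k : A W O) O' (h : O' <=o O) (l : O' <=o u W) p :
  res (presheaf_inverse_image u G) h p =
  pgen _ (NbhdSection l (nbhd_eval_app k p)).
Proof.
have lin c (s t : G W) : pgen (@nbhd_rel K D C u G O') (NbhdSection l (c *: s + t)) =
    c *: pgen _ (NbhdSection l s) + pgen _ (NbhdSection l t).
  apply: etrans (pclass_eq (nbhd_rel_linear l c s t)) _.
  by rewrite /pclass sqpiD ?sqpiZ.
elim/presented_ind: p => [|c [W1 m t] p IH].
  (* The generator attached to the zero section is not 0 by definition; the linear relation makes it
     equal to its own double. *)
  rewrite !linear0; have := lin 1 0 0; rewrite scaler0 add0r scale1r => E.
  by apply: addrI; rewrite addr0; exact: E.
rewrite (linearP (res _ h)) (linearP (nbhd_eval_app k)) lin IH.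
rewrite (nbhd_eval_appE k m t) (nbhd_res_pgen h m t).
have E := pclass_eq (nbhd_rel_res (site_le_trans h m) l (wb_le_op k m) t).
by rewrite [pgen _ _]E.
Qed.

End Evaluation.

Definition inverse_eval (G : sheaf K C) : cross A (inverse_image K u G) G :=
  sval (cross_extend (nbhd_eval G)
    (@sheafify_unit_onto _ _ _) (@sheafify_unit_faithful _ _ _)).

Lemma inverse_eval_unit (G : sheaf K C) W O (k : A W O) p :
  cross_app (inverse_eval G) k (sheafify_unit (presheaf_inverse_image u G) O p) =
  nbhd_eval_app G k p.
Proof.
exact: (svalP (cross_extend (nbhd_eval G)
  (@sheafify_unit_onto _ _ _) (@sheafify_unit_faithful _ _ _))).
Qed.

(* Unification diverges when it unfolds the terms declared opaque below. *)
#[local] Opaque inverse_eval.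

Lemma inverse_eval_section (G : sheaf K C) W O (k : A W O) W' (h : O <=o u W')
    (t : G W') (l : W <=o W') :
  cross_app (inverse_eval G) k (inverse_section h t) = res G l t.
Proof.
rewrite [LHS]inverse_eval_unit nbhd_eval_appE.
by rewrite (Prop_irrelevance l (wb_le_op k h)).
Qed.

Lemma nbhd_eval_kernel (G : presheaf K C) O (p : presheaf_inverse_image u G O) :
  (forall W (k : A W O), nbhd_eval_app G k p = 0) -> locally_zero p.
Proof.
move=> p0; apply: locally_sub (locally_self (wb_nbhd O)) => O' [h [W k l]].
exists h; rewrite (nbhd_evalK k h l) p0 -(linear0 (nbhd_eval_app G k)).
by rewrite -(nbhd_evalK k h l) linear0.
Qed.

Lemma inverse_eval_eq (G : sheaf K C) O (y z : inverse_image K u G O) :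
  (forall W (k : A W O),
    cross_app (inverse_eval G) k y = cross_app (inverse_eval G) k z) -> y = z.
Proof.
move=> yz; apply/eqP; rewrite -subr_eq0; apply/eqP.
apply: (cross_joint_kernel (S := inverse_image K u G) (phi := nbhd_eval G)
  (@sheafify_unit_onto _ _ (presheaf_inverse_image u G))
  (@inverse_eval_unit G) (@nbhd_eval_kernel G)) => W k.
by rewrite linearB yz subrr.
Qed.

Lemma inverse_image_map_unit (G G' : sheaf K C) (f : pmor G G') O p :
  sf_mor (inverse_image K u) f O (sheafify_unit (presheaf_inverse_image u G) O p) =
  sheafify_unit (presheaf_inverse_image u G') O (presheaf_inverse_image_map u f O p).
Proof. exact: (sheafify_map_unit (presheaf_inverse_image_map u f)). Qed.

Lemma inverse_eval_nat (G G' : sheaf K C) (f : pmor G G') W O (k : A W O) y :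
  cross_app (inverse_eval G') k (sf_mor (inverse_image K u) f O y) =
  f W (cross_app (inverse_eval G) k y).
Proof.
apply: (cross_ext (phi := cross_pre (inverse_eval G') (sf_mor (inverse_image K u) f))
  (psi := cross_post f (inverse_eval G)) (@sheafify_unit_onto _ _ _)).
move=> W1 O1 k1 p.
suff : nbhd_eval_app G' k1 (presheaf_inverse_image_map u f O1 p) =
    f W1 (nbhd_eval_app G k1 p).
  rewrite -(inverse_eval_unit k1 p) -[nbhd_eval_app G' _ _](inverse_eval_unit k1).
  by rewrite -inverse_image_map_unit cross_preE cross_postE.
elim/presented_ind: p => [|c [W2 l t] p IH]; first by rewrite !linear0.
rewrite !linearP IH; congr (_ *: _ + _).
apply: etrans (congr1 (nbhd_eval_app G' k1) (presheaf_inverse_image_mapE f l t)) _.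
by rewrite !nbhd_eval_appE pmor_nat.
Qed.

(** On an [O'] contained in [u W] the section with the prescribed values is the class of the value
    on [W]. These classes glue because values determine a section. *)
Lemma inverse_eval_lift (F : presheaf K D) (G : sheaf K C) (phi : cross A F G) :
  {f : pmor F (inverse_image K u G) | forall W O (k : A W O) s,
    cross_app (inverse_eval G) k (f O s) = cross_app phi k s}.
Proof.
pose IG : sheaf K D := inverse_image K u G.
pose R O O' (s : F O) (y : IG O') := exists h : O' <=o O, forall W (k : A W O')
  (k' : A W O), cross_app (inverse_eval G) k y = cross_app phi k' s.
have ex O : exists f : {linear F O -> IG O}, forall s W (k : A W O),
    cross_app (inverse_eval G) k (f s) = cross_app phi k s.
  have [||||f fE] := @glue_linear K D IG (F O) (R O) O.
  - move=> V V' h a x [l yE]; exists (site_le_trans h l) => W k k'.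
    have k2 := wb_mono (site_le_refl W) h k.
    by rewrite (cross_natr _ k k2) (yE _ k2 k').
  - move=> V c a b x y [l xE] [_ yE]; exists l => W k k'.
    by rewrite !linearP (xE _ k k') (yE _ k k').
  - move=> V x [l xE]; apply: inverse_eval_eq => W k.
    by rewrite (xE _ k (wb_mono (site_le_refl W) l k)) !linear0.
  - move=> s; apply: locally_sub (locally_self (wb_nbhd O)).
    move=> O' [h [W k l]]; exists (inverse_section l (cross_app phi k s)), h.
    move=> W' k1 k2; rewrite (inverse_eval_section k1 l _ (wb_le_op k1 l)).
    exact: cross_natl.
  (* Gluing describes [f s] on small pieces of [O] only; the value on an arbitrary [W] is compared
     on a covering of [W] whose members are below such pieces. *)
  exists f => s W k; apply: sheaf_eq.
  apply: locally_sub (wb_locally k (locally_self (wb_nbhd O))).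
  move=> V [h [ O' [l [_ [W1 k1 l1]] k2]]] h'.
  have k3 := wb_mono (site_le_refl V) l k2.
  rewrite !(cross_natl _ k k3) -(cross_natr _ k2 k3 l).
  rewrite (fE s _ l (inverse_section l1 (cross_app phi k1 s))).
    rewrite (inverse_eval_section k2 l1 _ (wb_le_op k2 l1)).
    exact: cross_natl.
  exists l => W' k4 k5; rewrite (inverse_eval_section k4 l1 _ (wb_le_op k4 l1)).
  exact: cross_natl.
pose f O := projT1 (cid (ex O)).
have fE O s W (k : A W O) : cross_app (inverse_eval G) k (f O s) = cross_app phi k s.
  by rewrite /f; case: cid.
have fn O O' (h : O' <=o O) s : res IG h (f O s) = f O' (res F h s).
  apply: inverse_eval_eq => W k; have k' := wb_mono (site_le_refl W) h k.
  by rewrite fE !(cross_natr _ k k') fE.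
by exists (Pmor fn) => W O k s; exact: fE.
Qed.

End InverseImageEvaluation.

(** * Tensor products and the adjunction *)

Section TensorSections.
Context (K : fieldType) (C : site).

Lemma tensor_section_res (F G : sheaf K C) U V (h : V <=o U) (s : F U) (t : G U) :
  res (sheaf_tensor F G) h (tensor_section s t) =
  tensor_section (res F h s) (res G h t).
Proof.
apply: etrans (pmor_nat _ _ _) _; congr (sheafify_unit _ _ _); exact: pmapE.
Qed.

Lemma sheaf_tensor_map_section (F F' G G' : sheaf K C) (f : pmor F F')
    (g : pmor G G') U (s : F U) (t : G U) :
  sheaf_tensor_map f g U (tensor_section s t) = tensor_section (f U s) (g U t).
Proof.
apply: etrans (sheafify_map_unit _ _) _; congr (sheafify_unit _ _ _).
exact: pmapE.
Qed.

Lemma pure_tensor_linearl (V W : lmodType K) c (v v' : V) (w : W) :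
  pure_tensor (c *: v + v') w = c *: pure_tensor v w + pure_tensor v' w.
Proof.
apply: etrans (pclass_eq (tensor_rel_l c v v' w)) _.
by rewrite /pclass sqpiD ?sqpiZ.
Qed.

Lemma pure_tensor_linearr (V W : lmodType K) c (v : V) (w w' : W) :
  pure_tensor v (c *: w + w') = c *: pure_tensor v w + pure_tensor v w'.
Proof.
apply: etrans (pclass_eq (tensor_rel_r c v w w')) _.
by rewrite /pclass sqpiD ?sqpiZ.
Qed.

Lemma tensor_section_linearl (F G : sheaf K C) U c (s s' : F U) (t : G U) :
  tensor_section (c *: s + s') t = c *: tensor_section s t + tensor_section s' t.
Proof. by rewrite /tensor_section pure_tensor_linearl linearP. Qed.

Lemma tensor_section_linearr (F G : sheaf K C) U c (s : F U) (t t' : G U) :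
  tensor_section s (c *: t + t') = c *: tensor_section s t + tensor_section s t'.
Proof. by rewrite /tensor_section pure_tensor_linearr linearP. Qed.

End TensorSections.

Section CrossTensor.
Context (K : fieldType) (C D : site) (A : approximation C D).
Context (F G : sheaf K D) (H : sheaf K C).

(** Bilinear families are linear families on the presheaf tensor product, and [cross_extend] carries
    these across its sheafification. *)
Lemma cross_tensor_lift (b : forall W O, A W O -> F O -> G O -> H W) :
  (forall W O (k : A W O) c s s' t, b W O k (c *: s + s') t =
    c *: b W O k s t + b W O k s' t) ->
  (forall W O (k : A W O) c s t t', b W O k s (c *: t + t') =
    c *: b W O k s t + b W O k s t') ->
  (forall W W' O O' (k : A W O) (k' : A W' O') (h : W' <=o W) (h' : O <=o O') s t,
    res H h (b W O k (res F h' s) (res G h' t)) = b W' O' k' s t) ->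
  {phi : cross A (sheaf_tensor F G) H | forall W O (k : A W O) s t,
    cross_app phi k (tensor_section s t) = b W O k s t}.
Proof.
move=> bl br bn.
have b0 W O (k : A W O) e : tensor_rel e ->
    freeg_lift (fun x : F O * G O => b W O k x.1 x.2) e = 0.
  case=> [c v v' w|c v w w']; rewrite linearB linearP !freeg_liftE /=.
    by rewrite bl subrr.
  by rewrite br subrr.
pose B W O k := presented_lift (b0 W O k).
have BE W O k s t : sval (B W O k) (pure_tensor s t) = b W O k s t.
  exact: (svalP (B W O k)).
have Bn W W' O O' (k : A W O) (k' : A W' O') (h : W' <=o W) (h' : O <=o O') p :
    res H h (sval (B W O k) (res (presheaf_tensor F G) h' p)) = sval (B W' O' k') p.
  elim/presented_ind: p => [|c [s t] p IH]; first by rewrite !linear0.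
  rewrite !linearP IH; congr (_ *: _ + _).
  have -> : res (presheaf_tensor F G) h' (pgen _ (s, t)) =
      pure_tensor (res F h' s) (res G h' t) by exact: pmapE.
  by rewrite BE bn; apply/esym/BE.
have [phi phiE] := cross_extend (Cross Bn)
  (@sheafify_unit_onto _ _ (presheaf_tensor F G))
  (@sheafify_unit_faithful _ _ (presheaf_tensor F G)).
exists phi => W O k s t; apply: etrans (phiE _ _ k _) _; exact: BE.
Qed.

Lemma cross_tensor_ext (phi psi : cross A (sheaf_tensor F G) H) :
  (forall W O (k : A W O) s t,
    cross_app phi k (tensor_section s t) = cross_app psi k (tensor_section s t)) ->
  forall W O (k : A W O) x, cross_app phi k x = cross_app psi k x.
Proof.
move=> E; apply: (cross_ext (@sheafify_unit_onto _ _ (presheaf_tensor F G))).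
move=> W O k p.
pose f := linear_of (linear_comp (cross_app phi k) (sheafify_unit (presheaf_tensor F G) O)).
pose g := linear_of (linear_comp (cross_app psi k) (sheafify_unit (presheaf_tensor F G) O)).
apply: (presented_ext (f := f) (g := g)) => -[s t]; exact: E.
Qed.

End CrossTensor.

Section CrossIdentity.
Context (K : fieldType) (C : site).

Lemma pmor_of_cross (F G : presheaf K C) (phi : cross (le_approximation C) F G) :
  {f : pmor F G | forall U s, f U s = cross_app phi (site_le_refl U) s}.
Proof.
have fn U V (h : V <=o U) s : res G h (cross_app phi (site_le_refl U) s) =
    cross_app phi (site_le_refl V) (res F h s).
  rewrite (cross_natr phi (site_le_refl V) (h : le_approximation C V U)).
  by rewrite (cross_natl phi _ (h : le_approximation C V U)).
by exists (Pmor fn).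
Qed.

Program Definition cross_of_pmor (F G : presheaf K C) (f : pmor F G) :
    cross (le_approximation C) F G :=
  @Cross _ _ _ (le_approximation C) F G
    (fun U V (h : U <=o V) => linear_of (linear_comp (res G h) (f V))) _.
Next Obligation.
move=> F G f W W' O O' k k' h h' s /=.
by rewrite -pmor_nat !(res_comp _ _ (site_le_trans k h')) (res_comp _ _ k').
Qed.

Lemma cross_of_pmorE (F G : presheaf K C) (f : pmor F G) U V (h : U <=o V) s :
  cross_app (cross_of_pmor f) (h : le_approximation C U V) s = res G h (f V s).
Proof. by []. Qed.

Lemma sheaf_tensor_ext (F G H : sheaf K C) (f g : pmor (sheaf_tensor F G) H) :
  (forall U s t, f U (tensor_section s t) = g U (tensor_section s t)) -> pmor_eq f g.
Proof.
move=> E U x; have := cross_tensor_ext (phi := cross_of_pmor f) (psi := cross_of_pmor g).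
move=> /(_ _ _ _ (site_le_refl U) x); rewrite !cross_of_pmorE !res_id; apply.
by move=> W O k s t; rewrite !cross_of_pmorE E.
Qed.

Lemma sheaf_tensor_lift (F G H : sheaf K C) (b : forall U, F U -> G U -> H U) :
  (forall U c s s' t, b U (c *: s + s') t = c *: b U s t + b U s' t) ->
  (forall U c s t t', b U s (c *: t + t') = c *: b U s t + b U s t') ->
  (forall U V (h : V <=o U) s t,
    res H h (b U s t) = b V (res F h s) (res G h t)) ->
  {f : pmor (sheaf_tensor F G) H |
    forall U s t, f U (tensor_section s t) = b U s t}.
Proof.
move=> bl br bn.
have [||W W' O O' k k' h h' s t|phi phiE] :=
  @cross_tensor_lift _ _ _ (le_approximation C) F G H
    (fun W O (k : W <=o O) s t => res H k (b O s t)).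
- by move=> *; rewrite bl linearP.
- by move=> *; rewrite br linearP.
- rewrite -bn !(res_comp _ _ (site_le_trans k h')) (res_comp _ _ k') //.
have [f fE] := pmor_of_cross phi.
by exists f => U s t; rewrite fE phiE res_id.
Qed.

End CrossIdentity.

#[local] Opaque sheaf_tensor tensor_section sheaf_tensor_map.

(** * The adjunction and the comparison of tensor products *)

Section Adjunction.
Context (K : fieldType) (C D : site) (A : approximation C D).
Context (L : presheaf K D -> sheaf K C) (ell : forall F, cross A F (L F)).
Context (ell_onto : forall (F : presheaf K D) W (x : L F W),
  locally (fun V => exists (h : V <=o W) O (k : A V O) s,
    cross_app (ell F) k s = res (L F) h x) W).
Context (ell_faithful : forall (F : presheaf K D) W O (k : A W O) (s : F O),
  cross_app (ell F) k s = 0 ->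
  locally (fun V => V <=o W /\
    exists O' (h : O' <=o O), A V O' /\ res F h s = 0) W).
Context (I : sheaf_functor K C D) (ev : forall G : sheaf K C, cross A (I G) G).
Context (ev_eq : forall (G : sheaf K C) O (y z : I G O),
  (forall W (k : A W O), cross_app (ev G) k y = cross_app (ev G) k z) -> y = z).
Context (ev_nat : forall (G G' : sheaf K C) (f : pmor G G') W O (k : A W O) y,
  cross_app (ev G') k (sf_mor I f O y) = f W (cross_app (ev G) k y)).
Context (ev_lift : forall (F : presheaf K D) (G : sheaf K C) (phi : cross A F G),
  {f : pmor F (I G) | forall W O (k : A W O) s,
    cross_app (ev G) k (f O s) = cross_app phi k s}).

Local Notation shriek := (shriek ell_onto ell_faithful).
Local Notation shriek_lift := (shriek_lift ell_onto ell_faithful).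

Definition shriek_unit (F : presheaf K D) : pmor F (I (L F)) :=
  sval (ev_lift (ell F)).

Lemma ev_unit (F : presheaf K D) W O (k : A W O) s :
  cross_app (ev (L F)) k (shriek_unit F O s) = cross_app (ell F) k s.
Proof. exact: (svalP (ev_lift (ell F))). Qed.

Definition shriek_counit (G : sheaf K C) : pmor (L (I G)) G :=
  sval (shriek_lift (ev G)).

Lemma counit_ell (G : sheaf K C) W O (k : A W O) s :
  shriek_counit G W (cross_app (ell (I G)) k s) = cross_app (ev G) k s.
Proof. exact: (svalP (shriek_lift (ev G))). Qed.

Lemma shriek_mapE (F G : sheaf K D) (f : pmor F G) W O (k : A W O) s :
  sf_mor shriek f W (cross_app (ell F) k s) = cross_app (ell G) k (f O s).
Proof. exact: shriek_map_ell. Qed.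

(** Unit and counit correspond to [ell] and [ev] under the two universal properties. Morphisms into
    [I G] are compared through [ev], morphisms out of [L F] on the sections [ell k s]. *)
Program Definition shriek_adjunction : adjunction shriek I :=
  @Adjunction _ _ _ shriek I (fun F => shriek_unit F) shriek_counit _ _ _ _.
Next Obligation.
move=> F G g O s; apply: ev_eq => W k /=.
by rewrite ev_unit ev_nat ev_unit shriek_mapE.
Qed.
Next Obligation.
move=> F G f; apply: (ell_ext ell_onto) => W O k s /=.
by rewrite shriek_mapE !counit_ell ev_nat.
Qed.
Next Obligation.
move=> F; apply: (ell_ext ell_onto) => W O k s /=.
by rewrite shriek_mapE counit_ell ev_unit.
Qed.
Next Obligation.
move=> G O y; apply: ev_eq => W k /=.
by rewrite ev_nat ev_unit counit_ell.
Qed.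

Section Tensor.

Lemma ell_agree (F : presheaf K D) W O O' (k : A W O) (k' : A W O') s s' :
  cross_app (ell F) k s = cross_app (ell F) k' s' ->
  locally (fun V => V <=o W /\ exists O1 (h : O1 <=o O) (h' : O1 <=o O'),
    A V O1 /\ res F h s = res F h' s') W.
Proof.
have [ O1 [h h' k1]] := wb_dir k k'.
rewrite -(cross_natr _ k1 k h) -(cross_natr _ k1 k' h') => /eqP.
rewrite -subr_eq0 -linearB => /eqP /ell_faithful; apply: locally_sub.
move=> V [VW [ O2 [l [k2 E]]]]; split=> //.
exists O2, (site_le_trans l h), (site_le_trans l h'); split=> //.
apply/eqP; rewrite -subr_eq0 -(res_comp h l) -(res_comp h' l) -linearB; exact/eqP.
Qed.

Context (F G : sheaf K D).
Local Notation FG := (sheaf_tensor F G).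

Lemma ell_tensor_agree W O O' (k : A W O) (k' : A W O') (s : F O) (s' : F O')
    (t : G O) (t' : G O') :
  cross_app (ell F) k s = cross_app (ell F) k' s' ->
  cross_app (ell G) k t = cross_app (ell G) k' t' ->
  cross_app (ell FG) k (tensor_section s t) =
  cross_app (ell FG) k' (tensor_section s' t').
Proof.
move=> /ell_agree sE /ell_agree tE; apply: sheaf_eq.
apply: locally_bind sE _ => V VW [_ [ O1 [h1 [h1' [k1 E1]]]]].
apply: locally_sub (locally_self (locally_le _ tE VW)); last first.
  move=> U V' VU [UW [ O2 [l [l' [k2 E2]]]]]; split; first exact: site_le_trans UW.
  by exists O2, l, l'; split=> //; exact: wb_le k2.
move=> V' [V'V [_ [ O2 [h2 [h2' [k2 E2]]]]]] h.
(* The two equalities hold over different opens [O1] and [O2]; over [O3] both hold, so the tensors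
   agree. *)
have [ O3 [l1 l2 k3]] := wb_dir (wb_le V'V k1) k2.
have m1 := site_le_trans l1 h1; have m1' := site_le_trans l1 h1'.
have m2 := site_le_trans l2 h2; have m2' := site_le_trans l2 h2'.
apply: etrans (cross_natl _ k (wb_le h k) h _) _.
apply: etrans _ (esym (cross_natl _ k' (wb_le h k') h _)).
rewrite -(cross_natr _ k3 _ m1) -(cross_natr _ k3 _ m1') !tensor_section_res.
have -> : res F m1 s = res F m1' s'.
  by rewrite -(res_comp h1 l1) -(res_comp h1' l1) E1.
suff -> : res G m1 t = res G m1' t' by [].
by rewrite (Prop_irrelevance m1 m2) (Prop_irrelevance m1' m2')
  -(res_comp h2 l2) -(res_comp h2' l2) E2.
Qed.

Lemma ell_tensor_glue W (x : L F W) (y : L G W) :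
  {z : L FG W | forall V (h : V <=o W) O (k : A V O) s t,
    cross_app (ell F) k s = res (L F) h x ->
    cross_app (ell G) k t = res (L G) h y ->
    res (L FG) h z = cross_app (ell FG) k (tensor_section s t)}.
Proof.
apply: cid.
pose R V (z : L FG V) := exists (h : V <=o W) O (k : A V O) s t,
  [/\ cross_app (ell F) k s = res (L F) h x,
      cross_app (ell G) k t = res (L G) h y &
      z = cross_app (ell FG) k (tensor_section s t)].
have [|||z zE] := @glue K C (L FG) R W.
- move=> V V' h _ [l [ O [k [s [t [sE tE ->]]]]]].
  exists (site_le_trans h l), O, (wb_le h k), s, t; split.
  + by rewrite -(cross_natl _ k _ h) sE (res_comp _ _ (site_le_trans h l)).
  + by rewrite -(cross_natl _ k _ h) tE (res_comp _ _ (site_le_trans h l)).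
  + exact: cross_natl.
- move=> V _ _ [h [ O [k [s [t [sE tE ->]]]]]] [h' [ O' [k' [s' [t' [sE' tE' ->]]]]]].
  by apply: ell_tensor_agree; rewrite ?sE ?sE' ?tE ?tE' (Prop_irrelevance h h').
- apply: locally_sub (ell_onto2 ell_onto x y) => V [h [ O [k [s [t [sE tE]]]]]].
  by exists (cross_app (ell FG) k (tensor_section s t)), h, O, k, s, t.
by exists z => V h O k s t sE tE; apply: zE; exists h, O, k, s, t.
Qed.

Lemma ell_onto3 (F1 F2 F3 : presheaf K D) W (x : L F1 W) (y : L F2 W) (z : L F3 W) :
  locally (fun V => exists (h : V <=o W) O (k : A V O) s t r,
    [/\ cross_app (ell F1) k s = res (L F1) h x,
        cross_app (ell F2) k t = res (L F2) h y &
        cross_app (ell F3) k r = res (L F3) h z]) W.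
Proof.
apply: locally_bind (ell_onto2 ell_onto x y) _.
move=> V _ [h [ O1 [k1 [s [t [sE tE]]]]]].
apply: locally_sub (ell_onto (res _ h z)) => V' [h' [ O2 [k2 [r rE]]]].
have [ O3 [l1 l2 k3]] := wb_dir (wb_le h' k1) k2.
exists (site_le_trans h' h), O3, k3, (res _ l1 s), (res _ l1 t), (res _ l2 r).
rewrite (cross_natr _ k3 k2) rE !(cross_natr _ k3 (wb_le h' k1)).
by rewrite -!(cross_natl _ k1 _ h') sE tE; split; exact: res_comp.
Qed.

(** The inverse of the comparison morphism. Its source is a tensor product over [C], so it comes
    from a bilinear map, glued from the tensors of representatives over a common open; additivity
    involves three sections, hence [ell_onto3]. *)
Lemma tensor_shriek :
  {psi : pmor (sheaf_tensor (L F) (L G)) (L FG) | forall W O (k : A W O) s t,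
    psi W (tensor_section (cross_app (ell F) k s) (cross_app (ell G) k t)) =
    cross_app (ell FG) k (tensor_section s t)}.
Proof.
pose b W x y := sval (@ell_tensor_glue W x y).
have bE W x y V (h : V <=o W) O (k : A V O) s t :
    cross_app (ell F) k s = res (L F) h x ->
    cross_app (ell G) k t = res (L G) h y ->
    res (L FG) h (b W x y) = cross_app (ell FG) k (tensor_section s t).
  exact: (svalP (@ell_tensor_glue W x y)).
have [|||psi psiE] := @sheaf_tensor_lift K C (L F) (L G) (L FG) b.
- move=> W c x x' y; apply: sheaf_eq; apply: locally_sub (ell_onto3 x x' y).
  move=> V [h [ O [k [s [s' [t [sE sE' tE]]]]]]] h'.
  rewrite (Prop_irrelevance h' h) linearP (bE _ _ _ _ _ _ _ _ _ sE tE).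
  rewrite (bE _ _ _ _ _ _ _ _ _ sE' tE).
  rewrite (bE _ _ _ _ h _ k (c *: s + s') t); last exact: tE.
    apply: etrans (congr1 (cross_app (ell FG) k) (tensor_section_linearl c s s' t)) _.
    exact: (linearP (cross_app (ell FG) k)).
  by rewrite linearP sE sE' -linearP.
- move=> W c x y y'; apply: sheaf_eq; apply: locally_sub (ell_onto3 x y y').
  move=> V [h [ O [k [s [t [t' [sE tE tE']]]]]]] h'.
  rewrite (Prop_irrelevance h' h) linearP (bE _ _ _ _ _ _ _ _ _ sE tE).
  rewrite (bE _ _ _ _ _ _ _ _ _ sE tE').
  rewrite (bE _ _ _ _ h _ k s (c *: t + t')); [|exact: sE|].
    apply: etrans (congr1 (cross_app (ell FG) k) (tensor_section_linearr c s t t')) _.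
    exact: (linearP (cross_app (ell FG) k)).
  by rewrite linearP tE tE' -linearP.
- move=> W V h x y; apply: sheaf_eq.
  apply: locally_sub (ell_onto2 ell_onto (res _ h x) (res _ h y)).
  move=> V' [l [ O [k [s [t [sE tE]]]]]] h'.
  rewrite (Prop_irrelevance h' l) (bE _ _ _ _ _ _ _ _ _ sE tE).
  rewrite (res_comp _ _ (site_le_trans l h)); apply: bE.
    by rewrite sE (res_comp _ _ (site_le_trans l h)).
  by rewrite tE (res_comp _ _ (site_le_trans l h)).
exists psi => W O k s t; rewrite psiE -[LHS](res_id (site_le_refl W)).
by apply: bE; rewrite res_id.
Qed.

Lemma shriek_tensor :
  {theta : pmor (L FG) (sheaf_tensor (L F) (L G)) | forall W O (k : A W O) s t,
    theta W (cross_app (ell FG) k (tensor_section s t)) =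
    tensor_section (cross_app (ell F) k s) (cross_app (ell G) k t)}.
Proof.
have [|||phi phiE] := @cross_tensor_lift _ _ _ A F G (sheaf_tensor (L F) (L G))
  (fun W O k s t => tensor_section (cross_app (ell F) k s) (cross_app (ell G) k t)).
- by move=> *; rewrite linearP tensor_section_linearl.
- by move=> *; rewrite linearP tensor_section_linearr.
- move=> W W' O O' k k' h h' s t; rewrite tensor_section_res.
  by rewrite !(cross_nat _ k k').
have [theta thetaE] := shriek_lift phi.
by exists theta => W O k s t; rewrite thetaE phiE.
Qed.

Lemma shriek_tensor_ext (H : sheaf K C) (f g : pmor (L FG) H) :
  (forall W O (k : A W O) s t,
    f W (cross_app (ell FG) k (tensor_section s t)) =
    g W (cross_app (ell FG) k (tensor_section s t))) -> pmor_eq f g.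
Proof.
move=> E; apply: (ell_ext ell_onto) => W O k s.
exact: (cross_tensor_ext (phi := cross_post f (ell FG)) (psi := cross_post g (ell FG)) E).
Qed.

Lemma tensor_shriek_ext (H : sheaf K C) (f g : pmor (sheaf_tensor (L F) (L G)) H) :
  (forall W O (k : A W O) s t,
    f W (tensor_section (cross_app (ell F) k s) (cross_app (ell G) k t)) =
    g W (tensor_section (cross_app (ell F) k s) (cross_app (ell G) k t))) ->
  pmor_eq f g.
Proof.
move=> E; apply: sheaf_tensor_ext => W x y; apply: sheaf_eq.
apply: locally_sub (ell_onto2 ell_onto x y) => V [h [ O [k [s [t [sE tE]]]]]] h'.
by rewrite (Prop_irrelevance h' h) (pmor_nat f) (pmor_nat g) !tensor_section_res -sE -tE E.
Qed.

End Tensor.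

Definition shriek_theta (F G : sheaf K D) := sval (shriek_tensor F G).

Lemma shriek_thetaE (F G : sheaf K D) W O (k : A W O) (s : F O) (t : G O) :
  shriek_theta F G W (cross_app (ell _) k (tensor_section s t)) =
  tensor_section (cross_app (ell F) k s) (cross_app (ell G) k t).
Proof. exact: (svalP (shriek_tensor F G)). Qed.

Lemma shriek_theta_iso (F G : sheaf K D) : sheaf_iso (shriek_theta F G).
Proof.
have [psi psiE] := tensor_shriek F G; exists psi; split.
  by apply: shriek_tensor_ext => W O k s t; rewrite /= shriek_thetaE psiE.
by apply: tensor_shriek_ext => W O k s t; rewrite /= psiE shriek_thetaE.
Qed.

Lemma shriek_theta_nat (F F' G G' : sheaf K D) (f : pmor F F') (g : pmor G G') :
  pmor_eq
    (pmor_comp (shriek_theta F' G') (sf_mor shriek (sheaf_tensor_map f g)))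
    (pmor_comp (sheaf_tensor_map (sf_mor shriek f) (sf_mor shriek g))
       (shriek_theta F G)).
Proof.
apply: shriek_tensor_ext => W O k s t /=.
rewrite shriek_thetaE shriek_mapE !sheaf_tensor_map_section shriek_thetaE.
by rewrite !shriek_mapE.
Qed.

(** The section [y] is known only by its values; in the application it is the class of the tensor
    product of [a] and [b], as the compatibility clause of [commutes_with_tensor] demands. *)
Lemma shriek_theta_section (F G : sheaf K D) O (s : F O) (t : G O)
    (y : I (sheaf_tensor (L F) (L G)) O) :
  (forall W (k : A W O), cross_app (ev _) k y =
    tensor_section (cross_app (ev _) k (shriek_unit F O s))
                   (cross_app (ev _) k (shriek_unit G O t))) ->
  sf_mor I (shriek_theta F G) O
    (shriek_unit (sheaf_tensor F G) O (tensor_section s t)) = y.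
Proof.
move=> yE; apply: ev_eq => W k.
by rewrite ev_nat yE !ev_unit shriek_thetaE.
Qed.

End Adjunction.

#[local] Opaque sheaf_tensor tensor_section sheaf_tensor_map.
#[local] Opaque ell inverse_eval.

(** The first hypothesis makes the colimits non-empty, the second lets a section near [O] be
    evaluated on [W], and the third lets such values determine a section and glue to one. *)
Theorem exact_left_adjoint_of_inverse_image (K : fieldType) (C D : site)
    (A : approximation C D) (u : site_morphism D C) :
  (forall W, exists O, A W O) ->
  (forall W O W', A W O -> O <=o u W' -> W <=o W') ->
  (forall O, locally (fun O' => exists2 W, A W O & O' <=o u W) O) ->
  exists (L : sheaf_functor K D C) (adj : adjunction L (inverse_image K u)),
    exact_functor L /\ commutes_with_tensor adj.
Proof.
move=> wb_top wb_le_op wb_nbhd.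
pose l := @ell K C D A wb_top.
have lo := @ell_onto K C D A wb_top; have lf := @ell_faithful K C D A wb_top.
pose e G := @inverse_eval K C D A u wb_le_op G.
have ee := @inverse_eval_eq K C D A u wb_le_op wb_nbhd.
have en := @inverse_eval_nat K C D A u wb_le_op.
have el := @inverse_eval_lift K C D A u wb_le_op wb_nbhd.
pose adj := shriek_adjunction (ell := l) lo lf (ev := e) ee en el.
exists (shriek (ell := l) lo lf), adj; split; first exact: shriek_exact.
exists (fun F G => shriek_theta lo lf F G).
split; [move=> F G; exact: shriek_theta_iso|
  move=> F F' G G' f g; exact: shriek_theta_nat|].
move=> F G O s t W h a b sE tE.
have := @shriek_theta_section K C D A _ l lo lf (inverse_image K u) e ee en el F G O s t (inverse_section h (tensor_section a b)).
apply => W' k.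
(* On [W'] the value of [inverse_section h c] is the restriction of [c], and restriction commutes
   with [tensor_section]. *)
have le := wb_le_op _ _ _ k h.
have eE (E : sheaf K C) (c : E W) : cross_app (e E) k (inverse_section h c) = res E le c.
  exact: inverse_eval_section.
apply: etrans (eE _ _) _; apply: etrans (tensor_section_res _ _ _) _.
rewrite -(eE _ a) -(eE _ b) -sE -tE.
by [].
Qed.

(** * Subanalytic boxes *)

Section AnalyticFunctions.
Context (R : realType).

Lemma monomial0 n (h : 'rV[R]_n) : monomial [ffun=> 0%N] h = 1.
Proof. by rewrite /monomial big1 // => i _; rewrite ffunE expr0. Qed.

Lemma box_sumD n N (F G : {ffun 'I_n -> nat} -> R) :
  box_sum N (fun a => F a + G a) = box_sum N F + box_sum N G.
Proof. exact: big_split. Qed.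

Lemma box_sumZ n N (c : R) (F : {ffun 'I_n -> nat} -> R) :
  box_sum N (fun a => c * F a) = c * box_sum N F.
Proof. by rewrite /box_sum mulr_sumr. Qed.

Lemma box_sum_eq n N (F G : {ffun 'I_n -> nat} -> R) :
  F =1 G -> box_sum N F = box_sum N G.
Proof. by move=> FG; apply: eq_bigr => a _; exact: FG. Qed.

Lemma le_box_sum n N (F G : {ffun 'I_n -> nat} -> R) :
  (forall a, F a <= G a) -> box_sum N F <= box_sum N G.
Proof. by move=> FG; apply: ler_sum => a _; exact: FG. Qed.

Lemma box_sum_delta n N (c : R) :
  box_sum N.+1 (fun a : {ffun 'I_n -> nat} => (a == [ffun=> 0%N])%:R * c) = c.
Proof.
rewrite /box_sum (bigD1 [ffun=> ord0]) //= big1 => [|a /eqP aN0].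
  rewrite addr0 (_ : _ == _) ?mul1r //.
  by apply/eqP/ffunP => i; rewrite !ffunE.
rewrite (_ : _ == _ = false) ?mul0r //; apply/eqP => /ffunP a0.
by apply: aN0; apply/ffunP => i; apply/val_inj; have := a0 i; rewrite !ffunE.
Qed.

(** In positive dimension the box of size 0 is empty and misses the constant term. Convergence
    ignores this one partial sum and the bound absorbs it, so sizes [N.+1] suffice. *)
Lemma analytic_atS n (f : 'rV[R]_n -> R) (x : 'rV[R]_n)
    (c : {ffun 'I_n -> nat} -> R) (r : R) : 0 < r ->
  (forall h : 'rV[R]_n, (forall i, `|h 0 i| < r) ->
    (exists B : R, forall N, box_sum N.+1 (fun a => `|c a * monomial a h|) <= B) /\
    (fun N => box_sum N.+1 (fun a => c a * monomial a h)) @ \oo --> f (x + h)) ->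
  analytic_at f x.
Proof.
move=> r0 H; exists c, r; split=> // h /H [[B HB] lim]; split.
  exists (Num.max B (box_sum 0 (fun a => `|c a * monomial a h|))) => -[|N].
    by rewrite le_max lexx orbT.
  by rewrite le_max HB.
by rewrite -cvg_shiftS.
Qed.

Lemma analytic_at_affine n (f : 'rV[R]_n -> R) (x : 'rV[R]_n) (b m : R) :
  analytic_at f x -> analytic_at (fun w => b + m * f w) x.
Proof.
move=> [c [r [r0 H]]].
(* The constant [b] is added to the coefficient of the zero multi-index. *)
apply: (@analytic_atS _ _ _ (fun a => (a == [ffun=> 0%N])%:R * b + m * c a) r) => //.
move=> h /H [[B HB] lim].
have E a : ((a == [ffun=> 0%N])%:R * b + m * c a) * monomial a h =
    (a == [ffun=> 0%N])%:R * b + m * (c a * monomial a h).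
  rewrite mulrDl mulrA; congr (_ + _).
  by case: eqP => [->|_]; rewrite ?mul0r // monomial0 mulr1.
split.
  exists (`|b| + `|m| * B) => N.
  apply: (@le_trans _ _ (box_sum N.+1 (fun a => (a == [ffun=> 0%N])%:R * `|b| +
      `|m| * `|c a * monomial a h|))).
    apply: le_box_sum => a; rewrite E (le_trans (ler_normD _ _)) //.
    by rewrite !normrM normr_nat !mulrA lexx.
  by rewrite box_sumD box_sum_delta box_sumZ lerD2l ler_wpM2l.
under eq_fun do rewrite (box_sum_eq _ E) box_sumD box_sum_delta box_sumZ.
apply: cvgD; first exact: cvg_cst.
by apply: cvgMr; move: lim; rewrite -cvg_shiftS.
Qed.

Section LeftVariables.
Context (n k : nat).

Definition left_exponent (T : Type) (a : {ffun 'I_(n + k) -> T}) : {ffun 'I_n -> T} :=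
  [ffun i => a (lshift k i)].

Definition right_exponent0 (a : {ffun 'I_(n + k) -> nat}) : bool :=
  [forall j : 'I_k, a (rshift n j) == 0%N].

Lemma box_sum_left N (F : {ffun 'I_n -> nat} -> R) :
  box_sum N.+1 (fun a => if right_exponent0 a then F (left_exponent a) else 0) =
  box_sum N.+1 F.
Proof.
(* Only exponents vanishing in the last [k] variables contribute; they are the extensions by zero of
   exponents in [n] variables. *)
pose ext (b : {ffun 'I_n -> 'I_N.+1}) : {ffun 'I_(n + k) -> 'I_N.+1} :=
  [ffun j => match fintype.split j with inl i => b i | inr _ => ord0 end].
rewrite /box_sum -big_mkcond /=.
rewrite (reindex_onto ext (@left_exponent _)) /=; last first.
  move=> a /forallP a0; apply/ffunP => j; rewrite !ffunE.
  case: fintype.splitP => i ji; first by rewrite !ffunE; congr (a _); apply: val_inj.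
  have := a0 i; rewrite ffunE => /eqP ai; apply: val_inj => /=; rewrite -ai.
  by congr (nat_of_ord (a _)); apply: val_inj.
have sl i : fintype.split (lshift k i : 'I_(n + k)) = inl i by exact: (unsplitK (inl i)).
have sr i : fintype.split (rshift n i : 'I_(n + k)) = inr i by exact: (unsplitK (inr i)).
apply: eq_big => [b|b _].
  have -> : left_exponent (ext b) = b by apply/ffunP => i; rewrite !ffunE sl.
  by rewrite eqxx andbT; apply/forallP => j; rewrite !ffunE sr.
by congr F; apply/ffunP => i; rewrite !ffunE sl.
Qed.

Lemma monomial_left (a : {ffun 'I_(n + k) -> nat}) (h : 'rV[R]_(n + k)) :
  right_exponent0 a -> monomial a h = monomial (left_exponent a) (lsubmx h).
Proof.
move=> /forallP a0; rewrite /monomial big_split_ord /= [X in _ * X]big1.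
  by rewrite mulr1; apply: eq_bigr => i _; rewrite !mxE ffunE.
by move=> j _; rewrite (eqP (a0 j)) expr0.
Qed.

Lemma analytic_at_lsubmx (f : 'rV[R]_n -> R) (x : 'rV[R]_(n + k)) :
  analytic_at f (lsubmx x) -> analytic_at (fun w => f (lsubmx w)) x.
Proof.
move=> [c [r [r0 H]]].
apply: (@analytic_atS _ _ _
  (fun a => if right_exponent0 a then c (left_exponent a) else 0) r) => // h hr.
have [i|[B HB] lim] := H (lsubmx h); first by rewrite mxE.
have E a : (if right_exponent0 a then c (left_exponent a) else 0) * monomial a h =
    if right_exponent0 a then
      c (left_exponent a) * monomial (left_exponent a) (lsubmx h) else 0.
  by case: ifP => [ra|_]; rewrite ?mul0r ?(monomial_left _ ra).
split.
  have E' a : `|(if right_exponent0 a then c (left_exponent a) else 0) * monomial a h| =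
      if right_exponent0 a then
        `|c (left_exponent a) * monomial (left_exponent a) (lsubmx h)| else 0.
    by rewrite E; case: ifP => // _; rewrite normr0.
  exists B => N; rewrite (box_sum_eq _ E').
  by rewrite (box_sum_left _ (fun a => `|c a * monomial a (lsubmx h)|)).
under eq_fun do rewrite (box_sum_eq _ E)
  (box_sum_left _ (fun a => c a * monomial a (lsubmx h))).
by move: lim; rewrite linearD -cvg_shiftS.
Qed.

End LeftVariables.
End AnalyticFunctions.

(** * Coordinate boxes and their intersections with subanalytic sets *)

Section CoordinateBoxes.
Context (R : realType) (X : analytic_manifold R).

Lemma nbhs_fst (T U : topologicalType) (z : T * U) (P : set T) :
  nbhs z.1 P -> nbhs z (fst @^-1` P).
Proof. by move=> zP; apply: (@cvg_fst T U (nbhs z.1) (nbhs z.2)); case: z zP. Qed.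

Lemma open_preimage_fst (T U : topologicalType) (P : set T) :
  open P -> open (fst @^-1` P : set (T * U)).
Proof.
by move=> oP; rewrite openE => z Pz; apply: nbhs_fst; exact: open_nbhs_nbhs.
Qed.

(** Read in another chart, a coordinate is a component of the transition map, analytic by
    [mfd_compat]; the [k] extra variables do not occur in its power series. *)
Lemma chart_coordinate_analytic k (c : chart R X (mfd_dim X)) (i : 'I_(mfd_dim X))
    (b m : R) : mfd_atlas c ->
  analytic_on (@product_atlas R X k) (fst @^-1` chart_dom c)
    (fun z => b + m * chart_map c z.1 0 i).
Proof.
move=> Ac z _ cz [d Ad ->] [/= dz _].
have [g [ga gE]] := mfd_compat Ad Ac dz cz i.
exists (fun w => b + m * g (lsubmx w)); split.
  apply: (@analytic_at_lsubmx R _ _ (fun w => b + m * g w) (row_mx _ z.2)).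
  by rewrite row_mxKl; exact: analytic_at_affine.
have := nbhs_fst (z := z) gE; apply: filterS => y /= ->.
by rewrite row_mxKl.
Qed.

Lemma semianalyticI (T : topologicalType) n (A : set (chart R T n)) (Z Z' : set T) :
  semianalytic A Z -> semianalytic A Z' -> semianalytic A (Z `&` Z').
Proof.
move=> sZ sZ' x.
have [U [oU Ux] [p [q [f [e [fU fE]]]]]] := sZ x.
have [U' [oU' Ux'] [p' [q' [f' [e' [fU' fE']]]]]] := sZ' x.
exists (U `&` U'); first by split=> //; exact: openI.
exists (p * p')%N, (q + q')%N.
(* Distributing the intersection over the unions gives one disjunct for each pair of disjuncts, with
   the conditions of both. *)
pose sp (i : 'I_(p * p')) : 'I_p * 'I_p' := enum_val (cast_ord (esym (mxvec_cast p p')) i).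
exists (fun i j => match fintype.split j with
  | inl l => f (sp i).1 l | inr l => f' (sp i).2 l end).
exists (fun i j => match fintype.split j with
  | inl l => e (sp i).1 l | inr l => e' (sp i).2 l end).
split.
  move=> i j y c [Uy Uy'] Ac cy.
  by case: fintype.split => l; [exact: (fU _ _ y c)|exact: (fU' _ _ y c)].
move=> y [Uy Uy']; split.
  move=> [/(fE y Uy) [i H] /(fE' y Uy') [i' H']].
  exists (cast_ord (mxvec_cast p p') (enum_rank (i, i'))) => j.
  rewrite /sp cast_ordK enum_rankK /=.
  by case: fintype.split => l; [exact: H|exact: H'].
move=> [i H]; split.
  apply/(fE y Uy); exists (sp i).1 => l; have := H (lshift q' l).
  by rewrite (unsplitK (inl l)).
apply/(fE' y Uy'); exists (sp i).2 => l; have := H (rshift q l).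
by rewrite (unsplitK (inr l)).
Qed.

(* A subanalytic set is locally a projection from some X * R^k, so intersecting
   it with [b] requires the cylinders over [b] to be semianalytic. *)
Definition stably_semianalytic (b : set X) : Prop :=
  forall k, semianalytic (@product_atlas R X k) (fst @^-1` b).

(** The inequalities make sense only on the chart domain. The closed set [q] separates two cases:
    near its points they describe [b], and off [q] the set [b] is empty. *)
Lemma chart_box_semianalytic (c : chart R X (mfd_dim X)) (a : 'rV[R]_(mfd_dim X)) (r : R)
    (b q : set X) : mfd_atlas c -> closed q -> q `<=` chart_dom c -> b `<=` q ->
  (forall y, chart_dom c y -> b y <-> forall i, `|a 0 i - chart_map c y 0 i| < r) ->
  stably_semianalytic b.
Proof.
move=> Ac cq qc bq bE k z.
have [od _ _ _] := mfd_chart Ac.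
have [qz|nqz] := pselect (q z.1).
  exists (fst @^-1` chart_dom c).
    by split; [exact: open_preimage_fst|exact: qc].
  exists 1%N, (mfd_dim X + mfd_dim X)%N, (fun _ j z => match fintype.split j with
    | inl i => (r - a 0 i) + 1 * chart_map c z.1 0 i
    | inr i => (r + a 0 i) + (-1) * chart_map c z.1 0 i end), (fun _ _ => false).
  split=> [_ j|y cy].
    by case: fintype.split => i; exact: chart_coordinate_analytic.
  rewrite [X in X <-> _](_ : _ = b y.1) // (bE _ cy); split=> [H|[_ H] i].
    exists ord0 => j; case: fintype.split => i; have := H i; rewrite ltr_norml => /andP[];
      rewrite ?mul1r ?mulN1r; lra.
  have := H (lshift _ i); rewrite (unsplitK (inl i)) mul1r => H1.
  have := H (rshift _ i); rewrite (unsplitK (inr i)) mulN1r => H2.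
  by rewrite ltr_norml; apply/andP; split; lra.
(* The empty set is the union of no disjuncts. *)
exists (fst @^-1` ~` q).
  by split=> //; apply: open_preimage_fst; exact: closed_openC.
exists 0%N, 0%N, (fun _ _ _ => 0), (fun _ _ => false); split=> [[]//|y nq].
by split=> [/bq/nq|[[]]].
Qed.

(** The compact cube [q] makes the box [b] relatively compact, hence subanalytic, and will serve as
    the closed set in [W << O]. *)
Lemma exists_box (x : X) (N : set X) : nbhs x N -> exists b q : set X,
  [/\ b x, open b, stably_semianalytic b, b `<=` q & compact q /\ q `<=` N].
Proof.
move=> xN; have [c Ac cx] := mfd_cover x.
have [od ccont cinj copen] := mfd_chart Ac.
pose a := chart_map c x.
pose O1 := chart_dom c `&` interior N.
have oO1 : open O1 by apply: openI => //; exact: open_interior.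
have O1x : O1 x by split.
have : nbhs a (chart_map c @` O1).
  apply: open_nbhs_nbhs; split; last by exists x.
  by apply: copen => // y [].
move=> /nbhs_ballP [e /= e0 eO1].
(* Half of [e], so that the closed cube of radius [r] lies in the open ball of radius [e]. *)
pose r := e / 2; have r0 : 0 < r by rewrite divr_gt0.
pose cube := [set v : 'rV[R]_(mfd_dim X) | forall i, `|a 0 i - v 0 i| <= r].
have cubeE v : cube v -> (chart_map c @` O1) v.
  move=> cv; apply: eO1; split=> // i j; rewrite (ord1 i) /ball /=.
  by apply: le_lt_trans (cv j) _; rewrite /r; lra.
have ccube : compact cube.
  have -> : cube = [set v | forall i, `[a 0 i - r, a 0 i + r]%classic (v ord0 i)].
    apply/seteqP; split=> v H i; have := H i; rewrite /= in_itv /= ler_norml.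
      by move=> /andP[]; lra.
    by move=> /andP[? ?]; apply/andP; split; lra.
  apply: (@rV_compact R _ (fun i => `[a 0 i - r, a 0 i + r]%classic)) => i.
  exact: segment_compact.
(* The inverse of the chart, with the irrelevant default [x] off its image. *)
pose g v := if pselect (exists2 y, chart_dom c y & chart_map c y = v) is left h
  then projT1 (cid2 h) else x.
have gE y : chart_dom c y -> g (chart_map c y) = y.
  move=> cy; rewrite /g; case: pselect => [h|]; last by case; exists y.
  by case: cid2 => /= y' cy' /cinj; apply.
pose q := g @` cube.
have qE y : q y <-> chart_dom c y /\ cube (chart_map c y).
  split=> [[v cv <-]|[cy cv]]; last by exists (chart_map c y) => //; exact: gE.
  by have [y' [cy' _] E] := cubeE _ cv; rewrite -E gE // E.
have cq : compact q.
  apply: continuous_compact => //; apply: continuous_in_subspaceT => v.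
  rewrite inE => /cubeE [y [cy _] <-] P; rewrite gE // => yP.
  have [ O' [[ oO' O'y] O'P]] : exists O', open_nbhs y O' /\ O' `<=` P.
    by move: yP; rewrite nbhsE => -[ O' ? ?]; exists O'.
  have : nbhs (chart_map c y) (chart_map c @` (chart_dom c `&` O')).
    apply: open_nbhs_nbhs; split; last by exists y.
    by apply: copen; [exact: openI|move=> ? []].
  by apply: filterS => _ [y' [cy' Oy'] <-]; rewrite /= gE //; exact: O'P.
pose b := [set y | chart_dom c y /\ ball a r (chart_map c y)].
have bE y : chart_dom c y -> b y <-> forall i, `|a 0 i - chart_map c y 0 i| < r.
  move=> cy; split=> [[_ [_ H]] i|H]; first exact: (H 0 i).
  by split=> //; split=> // i j; rewrite (ord1 i); exact: H.
have bq : b `<=` q.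
  move=> y by_; apply/qE; have cy := by_.1; split=> // i.
  exact/ltW/((bE y cy).1 by_).
exists b, q; split=> //.
- by split=> //; exact: ballxx.
- rewrite openE => y [cy ay]; apply: filterI; first exact: open_nbhs_nbhs.
  have := ccont y cy; apply; rewrite nbhs_ballP.
  (* The smallest margin over the coordinates; starting from [r] keeps it positive in dimension 0
     too. *)
  pose d := \big[Order.min/r]_i (r - `|a 0 i - chart_map c y 0 i|).
  have d0 : 0 < d.
    apply: lt_bigmin => // i _; rewrite subr_gt0; exact: (ay.2 0 i).
  exists d => // v yv; split=> // i j; rewrite (ord1 i).
  have dj : d <= r - `|a 0 j - chart_map c y 0 j| by exact: bigmin_le.
  have /= := yv.2 0 j; rewrite /ball /= => yvj.
  have -> : a 0 j - v 0 j = (a 0 j - chart_map c y 0 j) + (chart_map c y 0 j - v 0 j).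
    by rewrite addrA subrK.
  apply: le_lt_trans (ler_normD _ _) _; lra.
- apply: (@chart_box_semianalytic c a r b q) => //.
    exact: compact_closed (@mfd_hausdorff _ X) cq.
  by move=> y /qE[].
- split=> // y /qE [cy /cubeE [y' [cy' /interior_subset Ny'] /cinj E]].
  by rewrite -E.
Qed.

Lemma op_sa_box (b q : set X) : open b -> stably_semianalytic b -> b `<=` q ->
  compact q -> op_sa b.
Proof.
move=> ob sb bq cq; split=> // x; exists setT; first by split=> //; exact: openT.
(* With no extra variables [b] is the projection of its own cylinder, whose closure stays over the
   compact [q]. *)
exists 0%N, (fst @^-1` b); split=> //; last first.
  rewrite setIT; apply/seteqP; split=> [y by_|_ [z bz <-]//].
  by exists (y, 0).
have cT : compact [set: 'rV[R]_0].
  have -> : [set: 'rV[R]_0] = [set v | forall i : 'I_0, [set: R] (v ord0 i)].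
    by apply/seteqP; split=> v _ // [].
  by apply: (@rV_compact R _ (fun=> setT)) => -[].
apply: (subclosed_compact _ (compact_setX cq cT)); first exact: closed_closure.
have cl : closed (q `*` [set: 'rV[R]_0]).
  have -> : q `*` [set: 'rV[R]_0] = fst @^-1` q.
    by apply/seteqP; split=> [z []|z qz] //; split.
  rewrite -[fst @^-1` q]setCK; apply: open_closedC.
  by apply: (@open_preimage_fst _ _ (~` q)); apply/closed_openC; exact: compact_closed (@mfd_hausdorff _ X) cq.
rewrite [X in _ `<=` X](closure_id _).1 //.
by apply: closure_subset => z bz; split=> //; exact: bq.
Qed.

Lemma op_saI_box (U b : set X) : op_sa U -> open b -> stably_semianalytic b ->
  op_sa (U `&` b).
Proof.
move=> [oU sU] ob sb; split=> [|x]; first exact: openI.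
have [N xN [k [B [sB cB BE]]]] := sU x.
exists N => //; exists k, (B `&` fst @^-1` b); split.
- exact: semianalyticI.
- apply: (subclosed_compact _ cB); first exact: closed_closure.
  by apply: closure_subset => z [].
- rewrite setIAC BE; apply/seteqP; split=> [_ [[z Bz <-] bz]|_ [z [Bz bz] <-]].
    by exists z.
  by split=> //; exists z.
Qed.

End CoordinateBoxes.

(** * The subanalytic site *)

Lemma finite_subcover (T : topologicalType) (Q : set T) (b : T -> set T) :
  compact Q -> (forall x, Q x -> nbhs x (b x)) ->
  exists l : seq T, (forall x, x \in l -> Q x) /\
    forall y, Q y -> exists2 x, x \in l & b x y.
Proof.
move=> /compact_near_coveringP cQ Qb.
(* The properties that hold for all large enough finite lists form a filter; along it the
   near-covering form of compactness yields one list for all of [Q]. *)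
pose Fl : set_system (seq T) := [set P | exists l0 : seq T, forall l : seq T,
  {subset l0 <= l} -> P l].
have FlF : Filter Fl.
  split; first by exists [::].
  - move=> P P' [l0 H] [l0' H']; exists (l0 ++ l0') => l sl; split.
      by apply: H => x xl; apply: sl; rewrite mem_cat xl.
    by apply: H' => x xl; apply: sl; rewrite mem_cat xl orbT.
  - by move=> P P' PP' [l0 H]; exists l0 => l /H /PP'.
have [|l0 H] := cQ _ Fl (fun l y => exists x, [/\ x \in l, Q x & b x y]) FlF.
  move=> x Qx; exists (b x, [set l : seq T | x \in l]).
    by split=> /=; [exact: Qb|exists [:: x] => l; apply; rewrite mem_head].
  by move=> [y l] [/= bxy xl]; exists x.
exists [seq x <- l0 | `[< Q x >]]; split.
  by move=> x; rewrite mem_filter => /andP[/asboolP].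
move=> y Qy; have [x [xl Qx bxy]] := H l0 (fun _ => id) y Qy.
by exists x => //; rewrite mem_filter xl andbT; exact/asboolP.
Qed.

Lemma nbhs_seq (T : topologicalType) (I : eqType) (l : seq I) (V : I -> set T) (t : T) :
  (forall i, i \in l -> nbhs t (V i)) ->
  nbhs t [set u | forall i, i \in l -> V i u].
Proof.
elim: l => [_|i l IH H]; first by apply: filterS filterT.
have Hl : nbhs t [set u | forall i, i \in l -> V i u].
  by apply: IH => j jl; apply: H; rewrite in_cons jl orbT.
have Hi := H i (mem_head _ _).
apply: filterS2 Hi Hl => u ui ul j; rewrite in_cons => /orP[/eqP -> //|]; exact: ul.
Qed.

Section SubanalyticCoverings.
Context (R : realType) (X S : analytic_manifold R).

Lemma cov_sa1 (U : set X) : op_sa U -> cov_sa U [set U].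
Proof.
move=> sU; split=> [A ->|Q _]; first by split.
exists [set U]; split=> //.
by rewrite bigcup_set1.
Qed.

Lemma cov_open1 (V : set S) : open V -> cov_open V [set V].
Proof. by move=> oV; split=> [B ->//|]; rewrite bigcup_set1. Qed.

Lemma cov_sa_boxes (U : set X) (P : set X) (b : X -> set X) : op_sa U ->
  (forall x, P x -> open (b x) /\ stably_semianalytic (b x)) ->
  (forall Q, compact Q -> exists l : seq X, (forall x, x \in l -> P x) /\
    forall y, Q y -> U y -> exists2 x, x \in l & b x y) ->
  cov_sa U [set U `&` b x | x in P].
Proof.
move=> sU bP cov; split=> [_ [x Px <-]|Q cQ].
  by have [ob sb] := bP x Px; split; [exact: op_saI_box|move=> ? []].
have [l [lP lQ]] := cov Q cQ; exists [set U `&` b x | x in [set` l]]; split.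
- by apply: finite_image; exact: finite_seq.
- by move=> _ [x /= /lP Px <-]; exists x.
- apply/seteqP; split=> y [Qy]; first by move=> [_ [x _ <-] [Uy _]].
  by move=> Uy; split=> //; have [x xl bxy] := lQ y Qy Uy; exists (U `&` b x) => //; exists x.
Qed.

Definition rectangle (U : set X) (V : set S) (sU : op_sa U) (oV : open V) : sa_site X S :=
  exist _ (U `*` V) (op_rectangle sU oV).

(** Empty rectangles are disposed of here by empty families. A point of one factor then shows that
    the points of the other lie in the projection of [W]. *)
Lemma sa_cov_rectangles (W : sa_site X S) (C : set (sa_site X S)) :
  (forall W', C W' -> W' <=o W) ->
  (forall (U : set X) (V : set S), op_sa U -> open V -> U !=set0 -> V !=set0 ->
     U `*` V `<=` sval W ->
     exists F G, [/\ cov_sa U F, cov_open V G & forall A B (sA : op_sa A) (oB : open B),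
       F A -> G B -> A `<=` U -> B `<=` V -> C (rectangle sA oB)]) ->
  site_cov W C.
Proof.
move=> CW rect; split=> // U V sU oV UVW.
have [->|/set0P U0] := eqVneq U set0.
  exists set0, [set V]; split=> //; last exact: cov_open1.
  by split=> // Q _; exists set0; split=> //; rewrite bigcup_set0.
have [->|/set0P V0] := eqVneq V set0.
  exists [set U], set0; split=> //; first exact: cov_sa1.
  by split=> //; rewrite bigcup_set0.
have [F [G [UF VG FG]]] := rect U V sU oV U0 V0 UVW.
exists F, G; split=> // A B FA GB.
have [sA AU] := UF.1 A FA; have oB := VG.1 B GB.
have BV : B `<=` V by rewrite -VG.2 => y By; exists B.
exists ((A `*` B) `&` (U `*` V)).
  by exists (rectangle sA oB) => //; exact: FG.
by move=> -[x s] [/= Ax Bs]; split=> //; split; [exact: AU|exact: BV].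
Qed.

(** Supplies the compactness that the closed set in [W << O] lacks: after intersection with [q] it
    becomes compact. *)
Lemma relatively_compact_cover (W : sa_site X S) :
  site_cov W [set W' | W' <=o W /\
    exists2 q : set X, compact q & forall x s, sval W' (x, s) -> q x].
Proof.
apply: sa_cov_rectangles => [W' []//|U V sU oV _ _ UVW].
have /choice[bq bqP] : forall x : X, exists p : set X * set X,
    [/\ p.1 x, open p.1, stably_semianalytic p.1, p.1 `<=` p.2 & compact p.2].
  move=> x; have [b [q [bx ob sb bq [cq _]]]] := exists_box (@filterT _ (nbhs x) _).
  by exists (b, q).
exists [set U `&` (bq x).1 | x in setT], [set V]; split.
- apply: cov_sa_boxes => // [x _|Q cQ]; first by have [] := bqP x.
  have [x _|l [_ lQ]] := finite_subcover (b := fun x => (bq x).1) cQ.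
    by have [bx ob _ _ _] := bqP x; exact: open_nbhs_nbhs.
  by exists l; split=> // y Qy _; exact: lQ.
- exact: cov_open1.
- move=> A B sA oB [x _ AE] BE AU BV; split.
    by move=> -[y s] [/= Ay Bs]; apply: UVW; split; [exact: AU|exact: BV].
  have [_ _ _ bqx cq] := bqP x; exists (bq x).2 => // y s [/= Ay _].
  by apply: bqx; move: Ay; rewrite -AE => -[].
Qed.

(* The boxes of an admissible list have closures [k x] for which [k x * V] lies
   in a member of [T]. *)
Definition subordinate (T : set (usual_site (X * S)%type)) (q : set X) (V : set S)
    (l : seq X) (b k : X -> set X) : Prop :=
  (forall y, q y -> exists2 x, x \in l & b x y) /\
  forall x, x \in l -> [/\ open (b x), stably_semianalytic (b x),
    b x `<=` k x, closed (k x) &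
    exists2 O, T O & k x `*` V `<=` sval O].

Lemma tube (O : usual_site (X * S)%type) T (q : set X) (s : S) :
  site_cov O T -> compact q -> (forall x, q x -> sval O (x, s)) ->
  exists V l b k, [/\ open V, V s & subordinate T q V l b k].
Proof.
move=> [_ OT] cq qO.
have /choice[d dP] : forall x : X, exists d : (set X * set X) * set S, q x ->
    [/\ d.1.1 x, open d.1.1, stably_semianalytic d.1.1, d.1.1 `<=` d.1.2 &
      [/\ closed d.1.2, nbhs s d.2 & exists2 O', T O' & d.1.2 `*` d.2 `<=` sval O']].
  move=> x; have [qx|nqx] := pselect (q x); last by exists (set0, set0, set0).
  have [ O' TO' O'x] := OT _ (qO x qx).
  have : nbhs (x, s) (sval O') by apply: open_nbhs_nbhs; split=> //; exact: svalP.
  move=> [[N V] /= [xN sV] NV].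
  have [b [k [bx ob sb bk [ck kN]]]] := exists_box xN.
  exists (b, k, V) => _; split=> //; split=> //.
    exact: compact_closed (@mfd_hausdorff _ X) ck.
  by exists O' => // -[y t] [/= /kN Ny Vt]; exact: NV.
have [x qx|l [lq lc]] := finite_subcover (b := fun x => (d x).1.1) cq.
  by have [bx ob _ _ _] := dP x qx; exact: open_nbhs_nbhs.
(* The list is finite, so the neighbourhoods of [s] attached to its boxes have a common one. *)
pose V := interior [set t | forall x, x \in l -> (d x).2 t].
exists V, l, (fun x => (d x).1.1), (fun x => (d x).1.2); split.
- exact: open_interior.
- by apply: nbhs_seq => x /lq /dP [_ _ _ _ []].
- split=> // x xl; have [_ ob sb bk [ck _ [ O' TO' O'k]]] := dP x (lq x xl).
  split=> //; exists O' => // -[y t] [/= ky /interior_subset Vt].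
  by apply: O'k; split=> //; exact: Vt.
Qed.

Definition sa_below (W : sa_site X S) (O : usual_site (X * S)%type) : Prop :=
  exists2 q : set X, closed q & forall x s, sval W (x, s) ->
    q x /\ forall x', q x' -> sval O (x', s).

(** The list of boxes given by [tube] depends on the point of S, while a rectangle is covered by
    products of one covering of each factor. So [W] is made relatively compact in X, then cut along
    S into strips that each have one list, then each strip is cut along X by its boxes; [locally]
    composes the three coverings. *)
Lemma sa_below_cov (W : sa_site X S) O T : sa_below W O -> site_cov O T ->
  locally (fun W' => exists2 O', T O' & sa_below W' O') W.
Proof.
move=> [q0 clq WO] OT.
apply: (locally_cov (relatively_compact_cover W)) => W1 [W1W [q1 cq1 W1q]].
pose q := q0 `&` q1.
have cq : compact q by rewrite /q setIC; exact: compact_closedI.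
have W1O x s : sval W1 (x, s) -> q x /\ forall x', q x' -> sval O (x', s).
  move=> W1x; have [q0x qO] := WO _ _ (W1W _ W1x); split.
    by split=> //; exact: W1q W1x.
  by move=> x' [/qO].
have cov2 : site_cov W1 [set W2 | W2 <=o W1 /\ exists l b k,
    subordinate T q [set s | exists x, sval W2 (x, s)] l b k].
  apply: sa_cov_rectangles => [W2 []//|U V sU oV [u Uu] _ UVW].
  exists [set U], [set V' | [/\ open V', V' `<=` V & exists l b k,
    subordinate T q V' l b k]]; split.
  - exact: cov_sa1.
  - split=> [B []//|]; apply/seteqP; split=> [s [V' [_ V'V _] /V'V]//|s Vs].
    (* The point [u] shows that [s] is in the projection of [W1], so the compact set [q] times [s]
       lies in [O]. *)
    have Wus : sval W1 (u, s) by apply: UVW.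
    have [V0 [l [b [k [oV0 V0s [cov sub]]]]]] := tube OT cq (W1O _ _ Wus).2.
    exists (V0 `&` V) => //; split; [exact: openI|by move=> ? []|].
    exists l, b, k; split=> // x /sub [ob sb bk ck [ O' TO' kO']].
    split=> //; exists O' => // -[y t] [/= ky [V0t _]].
    exact: kO'.
  - move=> A B sA oB _ [_ _ [l [b [k [cov sub]]]]] AU BV; split.
      by move=> -[y s] [/= Ay Bs]; apply: UVW; split; [exact: AU|exact: BV].
    exists l, b, k; split=> // x /sub [ob sb bk ck [ O' TO' kO']].
    split=> //; exists O' => // -[y t] [/= ky [y' [_ Bt]]].
    exact: kO'.
apply: (locally_cov cov2) => W2 [W2W1 [l [b [k [cov sub]]]]].
have cov3 : site_cov W2 [set W3 | W3 <=o W2 /\ exists2 O', T O' & sa_below W3 O'].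
  apply: sa_cov_rectangles => [W3 []//|U V sU oV _ [v Vv] UVW].
  exists [set U `&` b x | x in [set` l]], [set V]; split.
  - apply: cov_sa_boxes => // [x /sub[]//|Q _]; exists l; split=> // y _ Uy.
    by apply: cov; apply: (W1O y v _).1; apply: W2W1; apply: UVW.
  - exact: cov_open1.
  - move=> A B sA oB [x /sub [ob sb bk ck [ O' TO' kO']] AE] BE AU BV; split.
      by move=> -[y s] [/= Ay Bs]; apply: UVW; split; [exact: AU|exact: BV].
    (* The closed hull [k x] of the box witnesses [W3 << O'], since its product with the projection
       of [W2] lies in [O']. *)
    exists O' => //; exists (k x) => // y s [/= Ay Bs].
    split; first by apply: bk; move: Ay; rewrite -AE => -[].
    move=> y' ky'; apply: kO'; split=> //=; exists y.
    by apply: UVW; split; [exact: AU|exact: BV].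
by apply: (locally_cov cov3) => W3 [_ W3P]; exact: locally_here.
Qed.

Program Definition sa_approximation : approximation (sa_site X S) (usual_site (X * S)%type) :=
  @Approximation _ _ sa_below _ sa_below_cov _.
Next Obligation.
move=> W W' O O' W'W OO' [q cq WO]; exists q => // x s /W'W /WO [qx qO].
by split=> // x' /qO /OO'.
Qed.
Next Obligation.
move=> W O O' [q cq WO] [q' cq' WO'].
exists (exist _ (sval O `&` sval O') (openI (svalP O) (svalP O'))); split.
- by move=> ? [].
- by move=> ? [].
- exists (q `&` q'); first exact: closedI.
  move=> x s Wx; have [qx qO] := WO _ _ Wx; have [qx' qO'] := WO' _ _ Wx.
  by split=> // x' [/qO ? /qO' ?].
Qed.

Lemma sa_below_top (W : sa_site X S) : exists O, sa_below W O.
Proof. by exists (exist _ setT openT), setT => //; exact: closedT. Qed.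

Lemma sa_below_le (W : sa_site X S) O W' : sa_below W O -> O <=o rho X S W' -> W <=o W'.
Proof.
move=> [q _ WO] OW'; suff : sval W `<=` sval W' by [].
by move=> [x s] /WO [qx qO]; apply: (OW' (x, s)); exact: qO.
Qed.

(** Products of a box and an open set of S are open in X_sa * S and form a basis of X * S; the
    compact [q] around the box puts them below [O]. *)
Lemma sa_below_nbhd (O : usual_site (X * S)%type) :
  locally (fun O' => exists2 W, sa_below W O & O' <=o rho X S W) O.
Proof.
pose T : set (usual_site (X * S)%type) :=
  [set O' | O' <=o O /\ exists2 W, sa_below W O & O' <=o rho X S W].
suff OT : site_cov O T.
  by apply: (locally_cov OT) => O' [_ O'P]; exact: locally_here.
split=> [ O' []//|[x s] Oxs].
have : nbhs (x, s) (sval O) by apply: open_nbhs_nbhs; split=> //; exact: svalP.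
move=> [[N V] /= [xN sV] NV].
have [b [q [bx ob sb bq [cq qN]]]] := exists_box xN.
pose W := rectangle (op_sa_box ob sb bq cq) (open_interior V).
exists (rho X S W); last by split.
split.
  move=> -[y t] [/= by_ /interior_subset Vt]; apply: NV; split=> //.
  exact/qN/(bq y).
exists W => //; exists q; first exact: compact_closed (@mfd_hausdorff _ X) cq.
move=> y t [/= by_ /interior_subset Vt]; split; first exact: (bq y).
by move=> y' /qN Ny'; exact: NV.
Qed.

End SubanalyticCoverings.

Local Close Scope classical_set_scope.

Theorem proposition3p3 (R : realType) (X S : analytic_manifold R) :
  exists (rho_shriek : sheaf_functor R[i] (usual_site (X * S)%type) (sa_site X S))
         (adj : adjunction rho_shriek (inverse_image R[i] (rho X S))),
    exact_functor rho_shriek /\ commutes_with_tensor adj.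
Proof.
apply: (@exact_left_adjoint_of_inverse_image _ _ _ (sa_approximation X S)).
- exact: sa_below_top.
- exact: sa_below_le.
- exact: sa_below_nbhd.
Qed.
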